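(* Let $k$ be a positive integer, $c\in\{0,1,\dots,k\}$, $n\ge 1$, and let $\lambda$ be a partition contained in $R=(c^{k+1-c})$. Then \[ D_{1^n}(\mathbf u_{w_\lambda})=\sum_{\{x_1,\dots,x_n\}}\mathbf u_{\lambda\setminus\{x_1,\dots,x_n\}}, \] where the sum ranges over all sets of $n$ distinct cells $x_a=(i_a,j_a)$ of $\lambda$, no two in the same row, satisfying (C2): if $i_a>i_b$ and $j_a<j_b$ for some $a,b$, then $(i_a,j_b)\notin\lambda$.
   Context: Affine symmetric group $W$: bijections $w:\mathbb Z\to\mathbb Z$ with $w(m+k+1)=w(m)+k+1$ and $\sum_{m=1}^{k+1}w(m)=\sum_{m=1}^{k+1}m$. For $r\in\{0,\dots,k\}$, $s_r$ exchanges $r+t(k+1)$ and $r+1+t(k+1)$ for all $t$; $s_a:=s_{a\bmod(k+1)}$. $\ell$ is Coxeter length. For $i\not\equiv j$ mod $k+1$, $t_{i,j}$ exchanges $i+t(k+1)$ and $j+t(k+1)$ for all $t$ and fixes other integers. Affine nilCoxeter algebra $\mathbb A$: generated by $\mathbf u_0,\dots,\mathbf u_k$ with $\mathbf u_r^2=0$, $\mathbf u_r\mathbf u_{r+1}\mathbf u_r=\mathbf u_{r+1}\mathbf u_r\mathbf u_{r+1}$ (indices mod $k+1$), $\mathbf u_r\mathbf u_q=\mathbf u_q\mathbf u_r$ if $r-q\not\equiv\pm1$; basis $\mathbf u_w=\mathbf u_{r_1}\cdots\mathbf u_{r_m}$ for reduced $w=s_{r_1}\cdots s_{r_m}$. Marked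 strong order graph: directed multigraph on $W$; for $x,y$ with $\ell(x)=\ell(y)+1$ and every pair of integers $(i,j)$ with $i\le0<j$ and $y\,t_{i,j}=x$, an edge $x\to y$ labelled $y(j)$. $D_{1^n}:\mathbb A\to\mathbb A$ is the linear operator with $D_{1^n}(\mathbf u_w)=\sum\mathbf u_{w_n}$ over all paths $w\xrightarrow{\ell_1}w_1\xrightarrow{\ell_2}\cdots\xrightarrow{\ell_n}w_n$ in this graph with $\ell_1<\ell_2<\cdots<\ell_n$ (i.e. the ascent composition of the label sequence is $[1,1,\dots,1]$). Diagrams: cell $(a,b)$ in row $a$ (from top), column $b$ (from left), residue $(b-a)\bmod(k+1)$. For a set $\mathcal D$ of cells read bottom row to top row, each row right to left, with residues $r_1,\dots,r_m$: $w_{\mathcal D}=s_{r_1}\cdots s_{r_m}$, $\mathbf u_{\mathcal D}=\mathbf u_{r_1}\cdots\mathbf u_{r_m}$. $w_\lambda$ is this for the diagram of $\lambda$; $\lambda\setminus X$ removes the cells of $X$.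
   Formalization: For k = 1 the braid relation u_0u_1u_0 = u_1u_0u_1 is not imposed on the affine nilCoxeter algebra, since with it the u_w would not be a basis and D_{1^n} would not be well defined; for k ≥ 2 the relations are as stated. *)

(* Defs.v *)
From HB Require Import structures.
From mathcomp Require Import all_boot all_order all_algebra.
From mathcomp Require Import finmap.
From mathcomp Require Import boolp classical_sets fsbigop.

Set Implicit Arguments.
Unset Strict Implicit.
Unset Printing Implicit Defensive.

Import Order.TTheory GRing.Theory Num.Theory.

Local Open Scope classical_set_scope.
Local Open Scope ring_scope.

(* Throughout, k > 0, so that 'Z_k.+1 is the ring of residues modulo k + 1.   *)

(** * The affine symmetric group *)

(* W, as a set of functions; its product v * w is the composition v \o w.     *)
Definition affine_perm (k : nat) : set (int -> int) :=
  [set w | [/\ bijective w,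
               forall m : int, w (m + k.+1%:Z) = w m + k.+1%:Z
             & \sum_(1 <= m < k.+2) w m%:Z = \sum_(1 <= m < k.+2) m%:Z]].

(* t_{i,j}; only meaningful when i and j are not congruent modulo k + 1.      *)
Definition affine_transp (k : nat) (i j : int) : int -> int :=
  fun m => if (m == i %[mod k.+1%:Z])%Z then m + (j - i)
           else if (m == j %[mod k.+1%:Z])%Z then m - (j - i)
           else m.

Definition simple_refl (k : nat) (r : 'Z_k.+1) : int -> int :=
  affine_transp k (r : nat)%:Z ((r : nat)%:Z + 1).

Definition word_perm (k : nat) (rs : seq 'Z_k.+1) : int -> int :=
  foldr (fun r w => simple_refl r \o w) id rs.

Definition reduced (k : nat) (rs : seq 'Z_k.+1) : Prop :=
  forall rs' : seq 'Z_k.+1,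
    word_perm rs' = word_perm rs -> (size rs <= size rs')%N.

(* Some reduced word of w (the empty word if w is not in W).                  *)
Definition reduced_word (k : nat) (w : int -> int) : seq 'Z_k.+1 :=
  xget [::] [set rs : seq 'Z_k.+1 | word_perm rs = w /\ reduced rs].

Definition coxeter_length (k : nat) (w : int -> int) : nat :=
  size (reduced_word k w).

(** * The affine nilCoxeter algebra *)

(* For k = 1 we have r + 1 = r - 1 and W is the infinite dihedral group, in   *)
(* which s_0 s_1 has infinite order: there is then no braid relation.         *)
Definition nilCoxeter_relations (K : comNzRingType) (k : nat) (A : algType K)
    (u : 'Z_k.+1 -> A) : Prop :=
  [/\ forall r, u r * u r = 0,
      (1 < k)%N ->
        forall r, u r * u (r + 1) * u r = u (r + 1) * u r * u (r + 1)
    & forall r q, r - q != 1 -> r - q != -1 -> u r * u q = u q * u r].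

(* A is the K-algebra presented by the generators u and these relations.      *)
Definition is_nilCoxeter (K : comNzRingType) (k : nat) (A : algType K)
    (u : 'Z_k.+1 -> A) : Prop :=
  nilCoxeter_relations u /\
  forall (B : algType K) (v : 'Z_k.+1 -> B), nilCoxeter_relations v ->
    exists2 f : {lrmorphism A -> B},
      (forall r, f (u r) = v r)
    & forall g : {lrmorphism A -> B}, (forall r, g (u r) = v r) -> g =1 f.

Definition u_word (K : comNzRingType) (k : nat) (A : algType K)
    (u : 'Z_k.+1 -> A) (rs : seq 'Z_k.+1) : A := \prod_(r <- rs) u r.

(* The basis element u_w, which does not depend on the reduced word chosen.   *)
Definition u_perm (K : comNzRingType) (k : nat) (A : algType K)
    (u : 'Z_k.+1 -> A) (w : int -> int) : A := u_word u (reduced_word k w).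

(** * The marked strong order graph *)

(* (y, (i, j)) stands for an edge with target y and marking pair (i, j).      *)
Notation marked_step := ((int -> int) * (int * int))%type.

Definition marked_edge (k : nat) (x : int -> int) (e : marked_step) : Prop :=
  let: (y, (i, j)) := e in
  [/\ affine_perm k x /\ affine_perm k y,
      coxeter_length k x = (coxeter_length k y).+1,
      i <= 0 /\ 0 < j,
      (i != j %[mod k.+1%:Z])%Z
    & y \o affine_transp k i j = x].

Definition edge_label (e : marked_step) : int := e.1 e.2.2.

Fixpoint marked_path (k : nat) (x : int -> int) (p : seq marked_step) : Prop :=
  if p is e :: p' then marked_edge k x e /\ marked_path k e.1 p' else True.

Definition path_end (x : int -> int) (p : seq marked_step) : int -> int :=
  last x (map fst p).

(* This set is finite, so the finitely supported sum over it in is_D1n is a   *)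
(* genuine sum.                                                               *)
Definition increasing_paths (k n : nat) (w : int -> int) :
    set (seq marked_step) :=
  [set p | [/\ size p = n, marked_path k w p
             & sorted <%R (map edge_label p)]].

(* D is the operator D_{1^n}.                                                 *)
Definition is_D1n (K : comNzRingType) (k : nat) (A : algType K)
    (u : 'Z_k.+1 -> A) (n : nat) (D : {linear A -> A}) : Prop :=
  forall w, affine_perm k w ->
    D (u_perm u w) = \sum_(p \in increasing_paths k n w) u_perm u (path_end w p).

(** * Diagrams *)

Definition is_partition (la : seq nat) : bool :=
  sorted geq la && (0%N \notin la).

(* Cells (row, column), both numbered from 1.                                 *)
Definition diagram (la : seq nat) : {fset nat * nat} :=
  [fset x in [seq (a.+1, b.+1) | a <- iota 0 (size la),
                                 b <- iota 0 (nth 0%N la a)]]%fset.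

Definition residue (k : nat) (x : nat * nat) : 'Z_k.+1 := x.2%:R - x.1%:R.

(* x is read before y: bottom row to top row, each row from right to left.    *)
Definition reads_before (x y : nat * nat) : bool :=
  ((y.1 < x.1) || ((x.1 == y.1) && (y.2 <= x.2)))%N.

Definition reading_word (k : nat) (X : {fset nat * nat}) : seq 'Z_k.+1 :=
  map (residue k) (sort reads_before X).

Definition w_diag (k : nat) (X : {fset nat * nat}) : int -> int :=
  word_perm (reading_word k X).

Definition u_diag (K : comNzRingType) (k : nat) (A : algType K)
    (u : 'Z_k.+1 -> A) (X : {fset nat * nat}) : A :=
  u_word u (reading_word k X).

Definition distinct_rows (X : {fset nat * nat}) : Prop :=
  forall x y, x \in X -> y \in X -> x.1 = y.1 -> x = y.

Definition cond_C2 (la : seq nat) (X : {fset nat * nat}) : Prop :=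
  forall x y, x \in X -> y \in X ->
    (y.1 < x.1)%N -> (x.2 < y.2)%N -> (x.1, y.2) \notin diagram la.

(* Main.v *)
Require Import Defs.
From HB Require Import structures.
From mathcomp Require Import all_boot all_order all_algebra.
From mathcomp Require Import finmap.
From mathcomp Require Import boolp classical_sets fsbigop.
From mathcomp Require Import zify.

Set Implicit Arguments.
Unset Strict Implicit.
Unset Printing Implicit Defensive.

Import Order.TTheory GRing.Theory Num.Theory.
Local Open Scope ring_scope.

(* The cell (a, b) of lambda corresponds to the inversion (1 - a, b) of w =   *)
(* w_lambda: the window values are w (1 - a) = lambda_a + 1 - a and w b = b - *)
(* lambda'_b, so that (a, b) is in lambda iff w b < w (1 - a). Deleting a     *)
(* letter of a word multiplies its permutation on the right by a reflection   *)
(* that only depends on the letters after it; for the cell (a, b) it is       *)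
(* t_{1-a,b}. Hence w_{lambda \ X} = w t_{x_1} ... t_{x_n}, where x_1, ...,   *)
(* x_n lists X from the bottom row to the top row. Conversely, along a marked *)
(* path from w with increasing labels, the labels being the values w (1 - a), *)
(* the rows a decrease strictly, and a transposition t_{1-a,b} lowers the     *)
(* length by exactly one iff no position between 1 - a and b carries a value  *)
(* between those at b and 1 - a: this is condition (C2). All words of lambda  *)
(* \ X that occur are then reduced, and u does not depend on the reduced      *)
(* word.                                                                      *)

(** Residues of cells of $R$ avoid $c$, so $w_\lambda$ and every permutation on the paths considered
    preserve the window $c-k,\dots,c$ and act there as in $S_{k+1}$. Removing cells becomes right
    multiplication by the reflections $t_{1-a,b}$ ([upper_cells_deletable], [cells_perm_delete]),
    and the theorem reduces to a bijection between increasing paths and admissible sets of cells,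
    listed in reading order as [good] lists ([increasing_pathsP]).

    The invariant [state] records the values after some deletions: rows above the deleted cells keep
    theirs, and a used column carries the row value of the last cell deleted in it. With these
    values, (C2) says exactly that no position strictly between $1-a$ and $b$ carries an
    intermediate value ([state_step_gap], and conversely [edge_good]).

    Lengths are obtained by squeezing. Inversions inside the window number at most the length
    ([size_inversions_le]). A reflection at an inversion lowers the length by at least one
    ([transp_down]); without an intermediate value it lowers the inversion count by at most one
    ([size_inversions_cover]). Both numbers are $|\lambda|$ at $w_\lambda$, so they stay equal and
    drop by one at each step ([state_length]). Hence admissible deletions are edges and the
    remaining cells spell a reduced word ([wdel_reduced]). An intermediate value would cost length
    at least three ([length_cover_gap]), so no other edges occur. Finally [matsumoto] identifies
    $\mathbf u_w$ with the product over the remaining cells. *)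

Section AffineWords.

Variable k : nat.

Implicit Types (i j m q x y z : int) (v w : int -> int).
Implicit Types (rs : seq 'Z_k.+1) (r : 'Z_k.+1).

Local Notation N := (k.+1%:Z).
Local Notation "x ~ y" := (x == y %[mod N])%Z (at level 70).
Local Notation "x !~ y" := (x != y %[mod N])%Z (at level 70).
Local Notation t := (affine_transp k).

(** * Congruence modulo $k+1$ and conjugation of affine transpositions *)

Lemma congP (x y : int) : reflect (exists q, x = y + q * N) (x ~ y).
Proof.
rewrite eqz_mod_dvd; apply: (iffP dvdzP) => -[q e]; exists q.
  by rewrite -e addrC subrK.
by rewrite e addrC addKr.
Qed.

Lemma modz_addMr (m q : int) : ((m + q * N) %% N)%Z = (m %% N)%Z.
Proof. by rewrite addrC modzMDl. Qed.

Lemma transp_l i j q : t i j (i + q * N) = j + q * N.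
Proof.
rewrite /affine_transp; case: congP => [_|[]]; first by lia.
by exists q.
Qed.

Lemma transp_r i j q : i !~ j -> t i j (j + q * N) = i + q * N.
Proof.
move=> nij; rewrite /affine_transp modz_addMr.
rewrite eq_sym (negbTE nij) eqxx; lia.
Qed.

Lemma transp_n i j m : m !~ i -> m !~ j -> t i j m = m.
Proof. by rewrite /affine_transp => /negbTE -> /negbTE ->. Qed.

Lemma transp_l0 i j : t i j i = j.
Proof. by have := transp_l i j 0; rewrite mul0r !addr0. Qed.

Lemma transp_r0 i j : i !~ j -> t i j j = i.
Proof. by move/(transp_r 0); rewrite mul0r !addr0. Qed.

Lemma transp_split i j m :
  [\/ exists q, m = i + q * N, exists q, m = j + q * N | m !~ i /\ m !~ j].
Proof.
case: (congP m i) => [|/congP/negP ni]; first by constructor 1.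
case: (congP m j) => [|/congP/negP nj]; first by constructor 2.
by constructor 3; split.
Qed.

Lemma transpK i j : i !~ j -> involutive (t i j).
Proof.
move=> nij m; case: (transp_split i j m) => [[q ->]|[q ->]|[ni nj]].
- by rewrite transp_l transp_r.
- by rewrite transp_r // transp_l.
- by rewrite !transp_n.
Qed.

Lemma transp_shift i j q : t (i + q * N) (j + q * N) = t i j.
Proof.
apply: funext => m; rewrite /affine_transp !modz_addMr.
by rewrite opprD addrACA subrr addr0.
Qed.

(** These are the properties of an affine permutation that make conjugation of $t_{i,j}$ work. *)
Definition pinj (w : int -> int) :=
  injective w /\ forall m q, w (m + q * N) = w m + q * N.

Lemma pinj_comp v w : pinj v -> pinj w -> pinj (v \o w).
Proof.
by move=> [iv pv] [iw pw]; split=> [|m q /=]; [exact: inj_comp|rewrite pw pv].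
Qed.

Lemma pinj_transp i j : i !~ j -> pinj (t i j).
Proof.
move=> nij; split; first exact/inv_inj/transpK.
move=> m q; rewrite /affine_transp modz_addMr.
by case: ifP => _; [|case: ifP => _]; lia.
Qed.

Lemma pinj_cong w x y : pinj w -> (w x ~ w y) = (x ~ y).
Proof.
move=> [iw pw]; apply/congP/congP => -[q e]; exists q.
  by apply: iw; rewrite pw.
by rewrite e pw.
Qed.

Lemma transp_conjE w i j m :
  pinj w -> i !~ j -> w (t i j m) = t (w i) (w j) (w m).
Proof.
move=> hw nij; have [iw pw] := hw.
case: (transp_split i j m) => [[q ->]|[q ->]|[ni nj]].
- by rewrite transp_l !pw transp_l.
- by rewrite transp_r // !pw transp_r // pinj_cong.
- by rewrite !transp_n // pinj_cong.
Qed.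

Lemma transp_conj w i j : pinj w -> i !~ j -> w \o t i j = t (w i) (w j) \o w.
Proof. by move=> hw nij; apply: funext => m /=; rewrite transp_conjE. Qed.

(** * Words in the simple reflections and Coxeter length *)

Hypothesis hk : (0 < k)%N.

Lemma cong_succF (x : int) : (x ~ x + 1) = false.
Proof. apply/negP => /congP[q e]; have [h|h] := leP 0 q; nia. Qed.

Lemma cong_Zp r (z : int) : r = z%:~R -> ((r : nat)%:Z ~ z).
Proof.
move=> ->; case: k hk z => // k' _ z.
have cast (n : nat) : ((n%:R : 'I_k'.+2) : nat)%:Z = (n%:Z %% k'.+2%:Z)%Z.
  by rewrite Zp_nat /= modz_nat.
case: z => n; first by rewrite -pmulrn cast modz_mod.
rewrite NegzE mulrNz -pmulrn /= Zp_nat /=.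
change (Zp_trunc k'.+2).+2 with k'.+2; rewrite -modz_nat modz_mod.
(* The representative of $-(n+1)$ is $p-((n+1)\bmod p)$ before its last reduction, with $p=k'+2$; it
   exceeds $-(n+1)$ by $p$ times this quotient. *)
rewrite eqz_mod_dvd; apply/dvdzP; exists ((n.+1 %/ k'.+2)%N%:Z + 1).
have := divn_eq n.+1 k'.+2; have := ltn_pmod n.+1 (ltn0Sn k'.+1); nia.
Qed.

Lemma simple_reflE r (z : int) :
  r = z%:~R -> simple_refl r = t z (z + 1).
Proof.
move/cong_Zp/congP => [q e]; rewrite /simple_refl e.
by rewrite -addrA [_ + 1]addrC addrA transp_shift.
Qed.

Lemma Zp_val_intr r : r = ((r : nat)%:Z)%:~R.
Proof. by rewrite -pmulrn natr_Zp. Qed.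

Lemma pinj_simple r : pinj (simple_refl r).
Proof. by apply: pinj_transp; rewrite cong_succF. Qed.

Lemma simple_reflK r : involutive (simple_refl r).
Proof. by apply: transpK; rewrite cong_succF. Qed.

Lemma word_perm_cat (rs1 rs2 : seq 'Z_k.+1) :
  word_perm (rs1 ++ rs2) = word_perm rs1 \o word_perm rs2.
Proof. by elim: rs1 => //= r rs ->. Qed.

Lemma word_perm_rcons rs r :
  word_perm (rcons rs r) = word_perm rs \o simple_refl r.
Proof. by rewrite -cats1 word_perm_cat. Qed.

Lemma pinj_word rs : pinj (word_perm rs).
Proof.
elim: rs => [|r rs IH] /=; first by split=> // x y.
exact: pinj_comp (pinj_simple r) IH.
Qed.

Lemma simple_refl_flip r (x y : int) :
  x < y -> simple_refl r y < simple_refl r x -> (x ~ (r : nat)%:Z) /\ y = x + 1.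
Proof.
rewrite /simple_refl /affine_transp; set z := (r : nat)%:Z => xy.
case: (congP x z) => [[q ex]|nx]; case: (congP y z) => [[q' ey]|ny].
- by lia.
- case: (congP y (z + 1)) => [[q' ey]|nz]; last by lia.
  by move=> h; split=> //; lia.
- by case: (congP x (z + 1)) => [[q'' ex]|nz]; lia.
- case: (congP x (z + 1)) => [[q'' ex]|nz]; first by case: congP; lia.
  case: (congP y (z + 1)) => [[q'' ey]|nz']; last by lia.
  by move=> h; case: nx; exists q''; lia.
Qed.

(** Applying the letters from right to left, some letter inverts the images of $i<j$. By
    [simple_refl_flip] these images are then the two adjacent values it exchanges, so this letter is
    the conjugate of $t_{i,j}$ by the word after it, and the two cancel. *)
Lemma deletion rs i j :
  i < j -> word_perm rs j < word_perm rs i ->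
  exists2 rs' : seq 'Z_k.+1, size rs = (size rs').+1 &
    word_perm rs' = word_perm rs \o t i j.
Proof.
move=> ij; elim: rs => [|r rs IH] /=; first by lia.
have [/IH[rs' szE wE] _|le_ij] := ltP (word_perm rs j) (word_perm rs i).
  by exists (r :: rs'); rewrite /= ?szE ?wE.
move=> h; have [wi wp] := pinj_word rs.
have lt_ij : word_perm rs i < word_perm rs j.
  by rewrite lt_neqAle le_ij andbT; apply/eqP => /wi; lia.
have [/congP[q e1] e2] := simple_refl_flip lt_ij h.
exists rs => //; have nij : i !~ j.
  by rewrite -(pinj_cong _ _ (pinj_word rs)) e2 cong_succF.
rewrite -compA (transp_conj (pinj_word rs) nij).
rewrite e2 e1 -addrA [_ + 1]addrC addrA transp_shift.
by apply: funext => m /=; rewrite -/(simple_refl r) simple_reflK.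
Qed.

(** [coxeter_length] falls back to 0 on functions without a word, so lengths are compared under this
    hypothesis. *)
Definition has_word (w : int -> int) := exists rs, word_perm rs = w.

Lemma has_word_pinj w : has_word w -> pinj w.
Proof. by move=> [rs <-]; exact: pinj_word. Qed.

Lemma reduced_wordP w : has_word w ->
  word_perm (reduced_word k w) = w /\ reduced (reduced_word k w).
Proof.
move=> [rs0 e0].
have : exists rs, word_perm rs = w /\ reduced rs.
  have [m lem] := ubnP (size rs0); elim: m rs0 e0 lem => // m IH rs0 e0 lem.
  have [red|] := pselect (reduced rs0); first by exists rs0.
  move=> /existsNP[rs' /not_implyP[e' /negP]]; rewrite -ltnNge => lt'.
  by apply: (IH rs'); [rewrite e'|exact: leq_trans lt' lem].
by move/(@xgetPex _ [::]
  [set rs : seq 'Z_k.+1 | word_perm rs = w /\ reduced rs]%classic).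
Qed.

Lemma coxeter_length_le w rs :
  word_perm rs = w -> (coxeter_length k w <= size rs)%N.
Proof.
by move=> e; have [e' red] := reduced_wordP (ex_intro _ rs e); apply: red; rewrite e.
Qed.

Lemma length_reduced rs :
  (size rs <= coxeter_length k (word_perm rs))%N -> reduced rs.
Proof.
by move=> le_sz rs' e; apply: leq_trans le_sz _; exact: coxeter_length_le.
Qed.

Lemma transp_down w i j : has_word w -> i < j -> w j < w i ->
  has_word (w \o t i j) /\ (coxeter_length k (w \o t i j) < coxeter_length k w)%N.
Proof.
move=> hw ij wij; have [e red] := reduced_wordP hw.
have [|rs' szE e'] := @deletion (reduced_word k w) i j ij; first by rewrite e.
rewrite e in e'; split; first by exists rs'.
by rewrite [X in (_ < X)%N]szE ltnS coxeter_length_le.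
Qed.

Lemma has_word_comp v w : has_word v -> has_word w -> has_word (v \o w).
Proof. by move=> [r1 <-] [r2 <-]; exists (r1 ++ r2); rewrite word_perm_cat. Qed.

Lemma has_word_simple z : has_word (t z (z + 1)).
Proof. by exists [:: z%:~R]; rewrite /= -(@simple_reflE z%:~R z). Qed.

Lemma has_word_transp i j : i < j -> i !~ j -> has_word (t i j).
Proof.
have [m] := ubnP (absz (j - i)); elim: m i j => // m IH i j lem ij nij.
have [->|nj] := eqVneq j (i + 1); first exact: has_word_simple.
set s := t i (i + 1).
have hs : pinj s by apply: pinj_transp; rewrite cong_succF.
have sK : involutive s by apply: transpK; rewrite cong_succF.
have si : s i = i + 1 by exact: transp_l0.
have sij : s i !~ s j by rewrite pinj_cong.
have e : t i j = s \o t (s i) (s j) \o s.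
  by rewrite -compA -transp_conj // compA; apply: funext => x /=; rewrite sK.
(* Conjugation by $s_i$ brings the two points closer: $i$ moves up by one, while $j$ could move up
   only if $j\equiv i$. *)
have ssj : i + 1 < s j /\ s j <= j.
  case: (transp_split i (i + 1) j) => [[q ej]|[q ej]|[n1 n2]].
  - by case/congP: nij; exists (- q); rewrite ej; lia.
  - have q1 : 1 <= q.
      have [q0|q0] := eqVneq q 0; first by rewrite ej q0 mul0r addr0 eqxx in nj.
      by have [//|h] := leP 1 q; nia.
    by rewrite /s ej transp_r ?cong_succF //; nia.
  - by rewrite /s transp_n //; lia.
rewrite e; apply: has_word_comp; last exact: has_word_simple.
apply: has_word_comp; first exact: has_word_simple.
by apply: IH => //; rewrite si; lia.
Qed.

(** Otherwise $(i,j)$ would be an inversion of $y$, and [transp_down] would make $x=y\,t_{i,j}$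
    shorter than $y$. *)
Lemma length_drop_desc (x y : int -> int) i j : has_word x -> i < j -> i !~ j ->
  y \o t i j = x -> coxeter_length k x = (coxeter_length k y).+1 -> x j < x i.
Proof.
move=> hx ij nij yx lenE; have tK := transpK nij.
have hy : has_word y.
  have -> : y = x \o t i j by rewrite -yx; apply: funext => m /=; rewrite tK.
  exact: has_word_comp (has_word_transp ij nij).
have [ix _] := has_word_pinj hx.
rewrite ltNge le_eqVlt; apply/negP => /orP[/eqP/ix|]; first by lia.
move=> lt_x; have lt_y : y j < y i.
  by move: lt_x; rewrite -yx /= transp_l0 transp_r0.
by have [_] := transp_down hy ij lt_y; rewrite yx lenE; lia.
Qed.

End AffineWords.

(** * Independence of $\mathbf u_w$ from the reduced word *)

Section Matsumoto.

Variables (k : nat) (hk : (0 < k)%N).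
Implicit Types (i j m q x y z : int) (v w : int -> int).
Implicit Types (rs : seq 'Z_k.+1) (r : 'Z_k.+1).

Local Notation N := (k.+1%:Z).
Local Notation "x ~ y" := (x == y %[mod N])%Z (at level 70).
Local Notation "x !~ y" := (x != y %[mod N])%Z (at level 70).
Local Notation t := (affine_transp k).

Lemma eq_intr_Zp x y : (x%:~R == y%:~R :> 'Z_k.+1) = (x ~ y).
Proof.
apply/eqP/idP => [e|/congP[q ->]].
  by rewrite -(eqP (cong_Zp hk e)) -(eqP (cong_Zp hk (erefl x%:~R))).
rewrite rmorphD rmorphM /= -pmulrn.
by rewrite (pchar_Zp (p := k.+1)) ?mulr0 ?addr0 // ltnS.
Qed.

Lemma reduced_word_eq rs rs' : reduced rs -> word_perm rs' = word_perm rs ->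
  (size rs' <= size rs)%N -> reduced rs'.
Proof.
move=> red e le_sz rs'' e''; apply: leq_trans le_sz _; apply: red.
by rewrite e'' e.
Qed.

Lemma reduced_rcons rs r : reduced (rcons rs r) -> reduced rs.
Proof.
move=> red rs' e; have := red (rcons rs' r).
by rewrite !word_perm_rcons e !size_rcons ltnS; apply.
Qed.

Lemma word_perm_rcons_inj rs rs' r :
  word_perm (rcons rs r) = word_perm (rcons rs' r) -> word_perm rs = word_perm rs'.
Proof.
rewrite !word_perm_rcons => e; apply: funext => x.
by have := congr1 (@^~ (simple_refl r x)) e; rewrite /= (simple_reflK hk).
Qed.

Lemma descent_word rs z : word_perm rs (z + 1) < word_perm rs z ->
  exists2 rs' : seq 'Z_k.+1, size rs = (size rs').+1 &
    word_perm (rcons rs' z%:~R) = word_perm rs.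
Proof.
move=> h; have [|rs' szE e] := @deletion k hk rs z (z + 1) _ h; first by lia.
exists rs' => //; rewrite word_perm_rcons e (simple_reflE hk (erefl z%:~R)).
by apply: funext => x /=; rewrite transpK // (cong_succF hk).
Qed.

Lemma reduced_descent rs z : reduced (rcons rs z%:~R) ->
  word_perm (rcons rs z%:~R) (z + 1) < word_perm (rcons rs z%:~R) z.
Proof.
move=> red; have [wi _] := pinj_word hk (rcons rs z%:~R).
rewrite ltNge le_eqVlt; apply/negP => /orP[/eqP/wi|]; first by lia.
rewrite word_perm_rcons (simple_reflE hk (erefl z%:~R)) /=.
rewrite transp_l0 transp_r0 ?(cong_succF hk) // => h.
have [rs' szE e] := descent_word h.
have := red rs'; rewrite size_rcons szE !word_perm_rcons -e word_perm_rcons.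
set r := z%:~R.
suff <- : word_perm rs' = word_perm rs' \o simple_refl r \o simple_refl r.
  by move=> /(_ erefl); lia.
by apply: funext => x /=; rewrite (simple_reflK hk).
Qed.

Lemma braid_transp z x : (1 < k)%N ->
  t z (z + 1) (t (z + 1) (z + 2) (t z (z + 1) x)) =
  t (z + 1) (z + 2) (t z (z + 1) (t (z + 1) (z + 2) x)).
Proof.
move=> k1; have n2 : z !~ z + 2.
  by apply/negP => /congP[q e]; have [h|h] := leP 0 q; nia.
have e2 : z + 2 = z + 1 + 1 by lia.
have n0 : z !~ z + 1 by rewrite cong_succF.
have n1 : z + 1 !~ z + 2 by rewrite e2 cong_succF.
rewrite (transp_conjE _ (pinj_transp n0) n1) transpK //.
rewrite (transp_conjE _ (pinj_transp n1) n0) transpK // transp_l0 transp_r0 //.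
rewrite [t (z + 1) (z + 2) z]transp_n // [t z (z + 1) (z + 2)]transp_n //.
- by rewrite eq_sym.
- by rewrite eq_sym.
Qed.

Variables (K : comNzRingType) (A : algType K) (u : 'Z_k.+1 -> A).
Hypothesis hu : nilCoxeter_relations u.

Lemma u_word_rcons rs r : u_word u (rcons rs r) = u_word u rs * u r.
Proof. by rewrite /u_word -cats1 big_cat big_seq1. Qed.

(* If w has right descents r and r', some two reduced words of w ending in r   *)
(* and in r' differ by a single commutation or braid relation.                *)
Definition linked rs r r' := exists (rs1 rs2 : seq 'Z_k.+1),
  [/\ (size rs1).+1 = size rs /\ size rs2 = size rs1,
      word_perm (rcons rs1 r) = word_perm rs,
      word_perm (rcons rs2 r') = word_perm rs
    & u_word u (rcons rs1 r) = u_word u (rcons rs2 r')].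

Lemma linked_sym rs r r' : linked rs r r' -> linked rs r' r.
Proof.
by move=> [rs1 [rs2 [[e1 e2] p1 p2 e]]]; exists rs2, rs1; rewrite e2.
Qed.

Lemma linked_comm rs x y : x !~ y -> x !~ y + 1 -> y !~ x + 1 ->
  word_perm rs (x + 1) < word_perm rs x ->
  word_perm rs (y + 1) < word_perm rs y -> linked rs x%:~R y%:~R.
Proof.
move=> nxy nxy1 nyx1 dx dy.
have nx := cong_succF hk x; have ny := cong_succF hk y.
have nxy2 : x + 1 !~ y + 1.
  apply: contra nxy => /congP[q e]; apply/congP; exists q; lia.
have ty : t x (x + 1) y = y by rewrite transp_n // eq_sym.
have ty1 : t x (x + 1) (y + 1) = y + 1 by rewrite transp_n // eq_sym.
have [rs1 sz1 e1] := descent_word dx.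
have w1E z : word_perm rs1 z = word_perm rs (t x (x + 1) z).
  rewrite -e1 word_perm_rcons (simple_reflE hk (erefl x%:~R)) /=.
  by rewrite transpK // nx.
have [|rs2 sz2 e2] := @descent_word rs1 y; first by rewrite !w1E ty ty1.
exists (rcons rs2 y%:~R), (rcons rs2 x%:~R); rewrite !size_rcons.
have [_ _ comm] := hu; split.
- by rewrite sz1 sz2.
- by rewrite word_perm_rcons e2 -word_perm_rcons.
- rewrite -e1 !word_perm_rcons -e2 word_perm_rcons.
  rewrite (simple_reflE hk (erefl x%:~R)) (simple_reflE hk (erefl y%:~R)).
  apply: funext => z /=; rewrite (transp_conjE (w := t x (x + 1))) ?ty ?ty1 ?ny //.
  by apply: pinj_transp; rewrite nx.
- rewrite !u_word_rcons -!mulrA; congr (_ * _); apply: comm.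
    by rewrite subr_eq -[1]/(1%:~R) -rmorphD eq_intr_Zp addrC.
  by rewrite -opprB eqr_opp subr_eq -[1]/(1%:~R) -rmorphD eq_intr_Zp addrC.
Qed.

Lemma linked_braid rs x :
  word_perm rs (x + 1) < word_perm rs x ->
  word_perm rs (x + 2) < word_perm rs (x + 1) -> linked rs x%:~R (x + 1)%:~R.
Proof.
move=> d0 d1; have [wi wp] := pinj_word hk rs.
(* For $k=1$, periodicity gives $w(x+2)=w(x)+2$, against the two consecutive descents. *)
have k1 : (1 < k)%N.
  rewrite ltnNge; apply/negP => k1.
  have eN : x + 1 * N = x + 2 by lia.
  by have := wp x 1; rewrite eN; lia.
have n2 : x !~ x + 2.
  by apply/negP => /congP[q e]; have [h|h] := leP 0 q; nia.
have e2 : x + 2 = x + 1 + 1 by lia.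
have n0 : x !~ x + 1 by rewrite cong_succF.
have n1 : x + 1 !~ x + 2 by rewrite e2 cong_succF.
have sx := simple_reflE hk (erefl x%:~R).
have sx1 := simple_reflE hk (erefl (x + 1)%:~R); rewrite -e2 in sx1.
have [rs1 sz1 e1] := descent_word d0.
have w1E z : word_perm rs1 z = word_perm rs (t x (x + 1) z).
  by rewrite -e1 word_perm_rcons sx /= transpK.
have [|rs2 sz2 e2'] := @descent_word rs1 (x + 1).
  rewrite -e2 !w1E transp_r0 // transp_n //; first exact: lt_trans d0.
  - by rewrite eq_sym.
  - by rewrite eq_sym.
have w2E z : word_perm rs2 z = word_perm rs1 (t (x + 1) (x + 2) z).
  by rewrite -e2' word_perm_rcons sx1 /= transpK.
have [|rs3 sz3 e3] := @descent_word rs2 x.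
  rewrite !w2E !w1E transp_l0 [X in _ < _ (t _ _ X)]transp_n // transp_l0.
  by rewrite transp_n // eq_sym.
pose a := x%:~R : 'Z_k.+1; pose b := (x + 1)%:~R : 'Z_k.+1.
exists (rcons (rcons rs3 a) b), (rcons (rcons rs3 b) a); rewrite !size_rcons.
have [_ braid _] := hu; split.
- by rewrite sz1 sz2 sz3.
- rewrite word_perm_rcons (word_perm_rcons _ b) e3.
  by rewrite -(word_perm_rcons _ b) e2' -word_perm_rcons.
- rewrite -e1 [RHS]word_perm_rcons -e2' (word_perm_rcons rs2) -e3.
  rewrite !word_perm_rcons sx sx1.
  by apply: funext => z /=; rewrite braid_transp.
- rewrite !u_word_rcons -!mulrA; congr (_ * _).
  have := braid k1 a; have -> : a + 1 = b by rewrite /b rmorphD.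
  by rewrite -!mulrA => ->.
Qed.

Lemma linked_descents rs x y :
  word_perm rs (x + 1) < word_perm rs x ->
  word_perm rs (y + 1) < word_perm rs y -> x !~ y -> linked rs x%:~R y%:~R.
Proof.
move=> dx dy nxy; have [wi wp] := pinj_word hk rs.
have shift z z' : (z ~ z') -> word_perm rs (z + 1) < word_perm rs z ->
    word_perm rs (z' + 1) < word_perm rs z'.
  by move=> /congP[q ->]; rewrite addrAC !wp ltrD2r.
have [hxy|nxy1] := boolP (x ~ y + 1).
  have -> : x%:~R = (y + 1)%:~R :> 'Z_k.+1 by apply/eqP; rewrite eq_intr_Zp.
  by apply/linked_sym/linked_braid => //; move: (shift _ _ hxy dx); rewrite -addrA.
have [hyx|nyx1] := boolP (y ~ x + 1); last exact: linked_comm.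
have -> : y%:~R = (x + 1)%:~R :> 'Z_k.+1 by apply/eqP; rewrite eq_intr_Zp.
by apply: linked_braid => //; move: (shift _ _ hyx dy); rewrite -addrA.
Qed.

Lemma matsumoto rs rs' : reduced rs -> reduced rs' ->
  word_perm rs = word_perm rs' -> u_word u rs = u_word u rs'.
Proof.
move=> red red' e.
have esz : size rs = size rs'.
  by apply/eqP; rewrite eqn_leq red ?red'.
elim: {rs}(size rs) {-2}rs rs' (erefl (size rs)) esz red red' e => [|n IH] rs rs'.
  by move=> /size0nil -> /esym/size0nil ->.
have same_last rs1 rs2 r : size (rcons rs1 r) = n.+1 -> size rs2 = size rs1 ->
    reduced (rcons rs1 r) -> reduced (rcons rs2 r) ->
    word_perm (rcons rs1 r) = word_perm (rcons rs2 r) ->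
    u_word u (rcons rs1 r) = u_word u (rcons rs2 r).
  rewrite size_rcons !u_word_rcons => -[sz1] sz2 red1 red2 e; congr (_ * _).
  apply: IH; rewrite ?sz2 //; first exact: reduced_rcons red1.
    exact: reduced_rcons red2.
  exact: word_perm_rcons_inj e.
case: (lastP rs) => // {}rs r sz.
case: (lastP rs') => [|{}rs' r' sz']; first by rewrite sz.
move=> red red' e.
have [er|nr] := eqVneq r r'.
  rewrite -er in red' e *; apply: same_last => //.
  by move: sz sz'; rewrite !size_rcons; lia.
pose x := (r : nat)%:Z; pose y := (r' : nat)%:Z.
have er : r = x%:~R := Zp_val_intr r; have er' : r' = y%:~R := Zp_val_intr r'.
(* The last letters differ and both are descents. The two linked words share their last letters with
   the given ones, so cancelling these reduces each comparison to the induction hypothesis. *)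
have [|||rs1 [rs2 [[sz1 sz2] e1 e2 eu]]] := @linked_descents (rcons rs r) x y.
- by rewrite er; apply: reduced_descent; rewrite -er.
- by rewrite e er'; apply: reduced_descent; rewrite -er'.
- by rewrite -eq_intr_Zp -er -er'.
rewrite -er -er' in e1 e2 eu.
rewrite size_rcons in sz1; case: sz1 => sz1.
have red1 : reduced (rcons rs1 r).
  by apply: (reduced_word_eq red) => //; rewrite !size_rcons sz1.
have red2 : reduced (rcons rs2 r').
  by apply: (reduced_word_eq red) => //; rewrite !size_rcons sz2 sz1.
rewrite (same_last rs rs1) // eu; apply: same_last => //.
- by rewrite size_rcons sz2 sz1 -(size_rcons rs r).
- by move: sz sz'; rewrite !size_rcons sz2 sz1 => -[->] [<-].
- by rewrite e2.
Qed.

Lemma u_perm_reduced rs : reduced rs -> u_perm u (word_perm rs) = u_word u rs.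
Proof.
move=> red; have [e red'] := reduced_wordP (ex_intro _ rs erefl).
exact: matsumoto.
Qed.

End Matsumoto.

(** * Closure of the affine symmetric group under reflections *)

Section AffinePerm.

Variable k : nat.
Implicit Types (i j m q x y z : int) (v w : int -> int).

Local Notation N := (k.+1%:Z).
Local Notation "x ~ y" := (x == y %[mod N])%Z (at level 70).
Local Notation "x !~ y" := (x != y %[mod N])%Z (at level 70).
Local Notation t := (affine_transp k).

Lemma sum_cong_period z : \sum_(1 <= m < k.+2) ((m%:Z ~ z) : nat)%:Z = 1.
Proof.
rewrite big_add1 big_mkord /=.
have z0 : 0 <= ((z - 1) %% N)%Z by exact: modz_ge0.
have zN : ((z - 1) %% N)%Z < N by exact: ltz_pmod.
have mP : (absz ((z - 1) %% N)%Z < k.+1)%N by lia.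
have eqE (m : 'I_k.+1) : (m.+1%:Z ~ z) = (m == Ordinal mP).
  apply/idP/eqP => [/congP[q e]|->].
    apply: val_inj => /=; have -> : z - 1 = m%:Z + (- q) * N by lia.
    by rewrite modz_addMr modz_small ?absz_nat //; have := ltn_ord m; lia.
  apply/congP; exists (- ((z - 1) %/ N)%Z) => /=.
  have := divz_eq (z - 1) N; move: z0; set a := modz _ _; set b := divz _ _; lia.
under eq_bigr => m _ do rewrite eqE.
by rewrite (bigD1 (Ordinal mP)) //= eqxx big1 ?addr0 // => m /negbTE ->.
Qed.

Lemma affine_perm_pinj w : affine_perm k w -> pinj k w.
Proof.
move=> [/bij_inj iw pw _]; split=> // m q.
have pwn (n : nat) x : w (x + n%:Z * N) = w x + n%:Z * N.
  elim: n => [|n IH]; first by rewrite mul0r !addr0.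
  have -> : x + n.+1%:Z * N = (x + n%:Z * N) + N by lia.
  by rewrite pw IH; lia.
have [|n|n] := intP q; first by rewrite mul0r !addr0.
  exact: (pwn n.+1).
by rewrite mulNr -[in RHS](subrK (n.+1%:Z * N) m) pwn addrK.
Qed.

Lemma affine_perm_transp w i j :
  affine_perm k w -> i !~ j -> affine_perm k (w \o t i j).
Proof.
move=> hw nij; have [iw pw] := affine_perm_pinj hw; case: (hw) => bw _ sw.
have tK := transpK nij; split.
- exact: bij_comp bw (Bijective tK tK).
- move=> m; have [_ /(_ m 1)] := pinj_transp nij.
  by rewrite !mul1r /= => ->; rewrite -[N]mul1r pw.
(* One summation index is congruent to $i$ and one to $j$; the value changes there by opposite
   amounts, so the normalised sum is preserved. *)
have e (m : nat) : w (t i j m%:Z) = w m%:Z +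
    (((m%:Z ~ i) : nat)%:Z - ((m%:Z ~ j) : nat)%:Z) * (w j - w i).
  case: (transp_split k i j m%:Z) => [[q ->]|[q ->]|[ni nj]].
  - by rewrite transp_l !modz_addMr eqxx (negbTE nij) !pw; lia.
  - by rewrite transp_r // !modz_addMr eqxx eq_sym (negbTE nij) !pw; lia.
  - by rewrite transp_n // (negbTE ni) (negbTE nj); lia.
rewrite /= (eq_bigr _ (fun n _ => e n)) big_split /= -mulr_suml big_split /=.
by rewrite sumrN !sum_cong_period subrr mul0r addr0 sw.
Qed.

Lemma affine_perm_word rs : (0 < k)%N -> affine_perm k (@word_perm k rs).
Proof.
move=> hk; elim/last_ind: rs => [|rs r IH]; first by split=> //; exists id.
by rewrite word_perm_rcons; apply: affine_perm_transp IH _; rewrite cong_succF.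
Qed.

End AffinePerm.

(** * The window, its stabiliser, and inversions inside it *)

Section Window.

Variables k c : nat.
Implicit Types (i j m q x y z : int) (v w : int -> int).

Local Notation N := (k.+1%:Z).
Local Notation "x ~ y" := (x == y %[mod N])%Z (at level 70).
Local Notation "x !~ y" := (x != y %[mod N])%Z (at level 70).
Local Notation t := (affine_transp k).

(* The values permuted by the parabolic subgroup generated by the s_r, r <> c. *)
Definition window : seq int := [seq c%:Z - k%:Z + n%:Z | n <- iota 0 k.+1].

Arguments window : simpl never.

Lemma mem_window z : (z \in window) = (c%:Z - k%:Z <= z <= c%:Z).
Proof.
apply/mapP/andP => [[n]|[z1 z2]]; first by rewrite mem_iota => h ->; lia.
by exists (absz (z - (c%:Z - k%:Z))%R); rewrite ?mem_iota; lia.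
Qed.

Lemma window_uniq : uniq window.
Proof. by rewrite map_inj_uniq ?iota_uniq // => x y; lia. Qed.

Lemma window_cong x y : x \in window -> y \in window -> (x ~ y) = (x == y).
Proof.
rewrite !mem_window => hx hy; apply/congP/eqP => [[q e]|->]; last first.
  by exists 0; rewrite mul0r addr0.
have [q0|q0] := eqVneq q 0; first by rewrite e q0 mul0r addr0.
by have [h|h] := leP 0 q; nia.
Qed.

Lemma transp_window i j m : i \in window -> j \in window -> m \in window ->
  t i j m = if m == i then j else if m == j then i else m.
Proof.
move=> hi hj hm; rewrite /affine_transp !window_cong //.
by case: eqP => [->|_]; [|case: eqP => [->|_]]; lia.
Qed.

(** Together with periodicity, this says that $w$ preserves every translate of the window. *)
Definition stable w := forall z, (w z <= c%:Z) = (z <= c%:Z).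

Lemma stable_transp i j : i \in window -> j \in window -> stable (t i j).
Proof.
rewrite !mem_window => hi hj z.
rewrite /affine_transp; case: (congP k z i) => [[q ->]|_].
  by have [|] := leP 1 q; [|have [|] := leP 0 q]; nia.
case: (congP k z j) => [[q ->]|//].
by have [|] := leP 1 q; [|have [|] := leP 0 q]; nia.
Qed.

Lemma stable_comp v w : stable v -> stable w -> stable (v \o w).
Proof. by move=> hv hw z; rewrite /= hv hw. Qed.

(** A stable permutation keeps the order between different translates of the window, so both ends of
    an inversion lie in one translate; $i\le 0<j$ singles out the window itself. *)
Lemma stable_inversion w i j : (c <= k)%N -> pinj k w -> stable w ->
  i <= 0 -> 0 < j -> w j < w i -> i \in window /\ j \in window.
Proof.
move=> hc [_ pw] sw i0 j0 wij.
have lo z : (w z <= c%:Z - N) = (z <= c%:Z - N).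
  have := sw (z + 1 * N); rewrite pw; lia.
by rewrite !mem_window; move: (lo i) (lo j) (sw i) (sw j); lia.
Qed.

(** For stable $w$, the inversion set of the permutation induced on the window. *)
Definition inversions w : seq (int * int) :=
  [seq p <- [seq (i, j) | i <- window, j <- window] | (p.1 < p.2) && (w p.2 < w p.1)].

Lemma inversions_uniq w : uniq (inversions w).
Proof.
apply: filter_uniq; apply: allpairs_uniq; rewrite ?window_uniq //.
by move=> [? ?] [? ?].
Qed.

Lemma mem_inversions w i j : ((i, j) \in inversions w) =
  [&& i \in window, j \in window, i < j & w j < w i].
Proof.
rewrite mem_filter andbC !andbA; congr (_ && _ && _).
apply/allpairsP/andP => [[[a b] [? ? [-> ->]]]//|[hi hj]].
by exists (i, j).
Qed.

Lemma size_inversions_cover w i j : injective w ->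
  i \in window -> j \in window -> i < j ->
  (forall m, i < m < j -> ~~ (w j < w m < w i)) ->
  (size (inversions w) <= (size (inversions (w \o t i j))).+1)%N.
Proof.
move=> iw hi hj ij gap; have nij : i !~ j by rewrite window_cong //; lia.
have tK := transpK nij; have tI := inv_inj tK.
(* An inversion other than $(i,j)$ is carried along by $t_{i,j}$ when its positions stay in order;
   otherwise it is kept, and the gap hypothesis shows that it is still an inversion of
   $w\,t_{i,j}$. *)
pose phi p := if t i j p.1 < t i j p.2 then (t i j p.1, t i j p.2) else p.
have phi_inj p p' : p.1 < p.2 -> p'.1 < p'.2 -> phi p = phi p' -> p = p'.
  case: p p' => [a b] [a' b'] /= ab ab'; rewrite /phi /=.
  case: ifP => h; case: ifP => h' //.
  - by case=> /tI -> /tI ->.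
  - by case=> e1 e2; move: h'; rewrite -e1 -e2 !tK ab.
  - by case=> e1 e2; move: h; rewrite e1 e2 !tK ab'.
set s := inversions w; have su : uniq s := inversions_uniq w.
have le_rem : (size s <= (size (rem (i, j) s)).+1)%N.
  have [hin|/rem_id -> //] := boolP ((i, j) \in s).
  by rewrite size_rem //; case: (size s).
apply: leq_trans le_rem _; rewrite ltnS -(size_map phi (rem _ _)).
have remP p : p \in rem (i, j) s -> p != (i, j) /\ p \in s.
  by rewrite mem_rem_uniq // inE => /andP.
apply: uniq_leq_size.
  rewrite map_inj_in_uniq ?rem_uniq // => -[a b] [a' b'].
  move=> /remP[_]; rewrite mem_inversions => /and4P[_ _ ab _].
  move=> /remP[_]; rewrite mem_inversions => /and4P[_ _ ab' _].
  exact: phi_inj.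
move=> _ /mapP[[a b] /remP[nab +] ->].
rewrite mem_inversions => /and4P[ha hb ab wab].
have ta := transp_window hi hj ha; have tb := transp_window hi hj hb.
rewrite /phi /=; case: ltP => h.
  rewrite mem_inversions h /= !tK wab !andbT ta tb.
  by apply/andP; split; case: ifP => // _; case: ifP.
rewrite mem_inversions ha hb ab /=; move: h; rewrite ta tb.
have nw x y : x != y -> w x != w y by move=> nxy; apply: contra nxy => /eqP/iw ->.
case: (eqVneq a i) => [ea|nai].
  have -> : (b == i) = false by lia.
  case: (eqVneq b j) => [eb|nbj] h; first by rewrite ea eb eqxx in nab.
  by have := gap b; have := nw b j nbj; rewrite ea in ab wab; lia.
case: (eqVneq a j) => [ea|naj].
  by have -> : (b == i) = false; [lia|case: eqVneq; lia].
case: (eqVneq b i) => [eb|nbi]; first by lia.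
case: (eqVneq b j) => [eb|nbj] h; last by lia.
by have := gap a; have := nw a i nai; rewrite eb in ab wab; lia.
Qed.

Lemma transp_sym i j : i !~ j -> t i j = t j i.
Proof.
move=> nij; apply: funext => m.
case: (transp_split k i j m) => [[q ->]|[q ->]|[ni nj]].
- by rewrite transp_l transp_r // eq_sym.
- by rewrite transp_r // transp_l.
- by rewrite !transp_n.
Qed.

Hypothesis hk : (0 < k)%N.

(** A new inversion must join the values congruent to $r$ and $r+1$ that $s_r$ exchanges. The window
    contains a single position whose value is congruent to $r$, which determines the pair. *)
Lemma size_inversions_simple w (r : 'Z_k.+1) : pinj k w ->
  (size (inversions (simple_refl r \o w)) <= (size (inversions w)).+1)%N.
Proof.
move=> hw; have [iw pw] := hw; set s := inversions _.
rewrite -(count_predC (mem (inversions w))) -!size_filter -addn1 leq_add //.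
  apply: uniq_leq_size; first exact/filter_uniq/inversions_uniq.
  by move=> p; rewrite mem_filter => /andP[].
set s' := filter _ _; have s'u : uniq s' by exact/filter_uniq/inversions_uniq.
have s'P p : p \in s' -> [/\ p.1 \in window, p.2 \in window,
    (w p.1 ~ (r : nat)%:Z) & w p.2 = w p.1 + 1].
  case: p => i j; rewrite mem_filter /= !mem_inversions.
  move=> /andP[+ /and4P[hi hj ij h]]; rewrite hi hj ij /= -leNgt le_eqVlt.
  case/orP => [/eqP/iw|lt_w]; first by lia.
  by have [e1 e2] := simple_refl_flip hk lt_w h.
case: s' s'u s'P => [//|p [//|p' s']] /= /andP[+ _] s'P.
have [h1 h2 h3 h4] := s'P p (mem_head _ _).
have [|h1' h2' h3' h4'] := s'P p'; first by rewrite !inE eqxx orbT.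
have e1 : p.1 = p'.1.
  by apply/eqP; rewrite -window_cong // -(pinj_cong _ _ hw) (eqP h3) (eqP h3').
have e2 : p.2 = p'.2 by apply: iw; rewrite h4 h4' e1.
by rewrite inE [p]surjective_pairing [p']surjective_pairing e1 e2 eqxx.
Qed.

Lemma size_inversions_le w : has_word k w ->
  (size (inversions w) <= coxeter_length k w)%N.
Proof.
move=> hw; have [e _] := reduced_wordP hw; rewrite /coxeter_length -{1}e.
elim: (reduced_word k w) => [|r rs IH] /=.
  rewrite leqn0 size_eq0 -[_ == _]negbK -has_filter; apply/hasPn => -[i j] _ /=.
  by lia.
by apply: leq_trans (size_inversions_simple _ _) _; [exact: pinj_word|].
Qed.

Lemma length_cover_gap w i j m : has_word k w -> i \in window -> j \in window ->
  i < m < j -> w j < w m < w i ->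
  (coxeter_length k (w \o t i j) + 2 < coxeter_length k w)%N.
Proof.
move=> hw hi hj /andP[im mj] /andP[wjm wmi].
have hm : m \in window by move: hi hj; rewrite !mem_window; lia.
have nim : i !~ m by rewrite window_cong //; lia.
have nij : i !~ j by rewrite window_cong //; lia.
have nmj : m !~ j by rewrite window_cong //; lia.
(* Each of the three factors, applied in turn on the right, is a reflection at an inversion and
   lowers the length. *)
have -> : t i j = t i m \o t i j \o t m j.
  apply: funext => x /=; rewrite (transp_conjE _ (pinj_transp nij) nmj).
  rewrite transp_r0 // [t i j m]transp_n // 1?eq_sym // (@transp_sym m i) 1?eq_sym //.
  by rewrite transpK.
have [hw1 l1] := transp_down hk hw im wmi.
have [||hw2 l2] := transp_down (i := i) (j := j) hk hw1; first by lia.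
  by rewrite /= transp_l0 transp_n // eq_sym.
have [||hw3 l3] := transp_down (i := m) (j := j) hk hw2; first by lia.
  rewrite /= transp_r0 // transp_l0 [t i j m]transp_n //; last by rewrite eq_sym.
  by rewrite transp_r0.
by apply: leq_ltn_trans l1; rewrite addn2; apply: leq_ltn_trans l2.
Qed.

End Window.

(** * Reading order and admissible lists of cells *)

Definition strictly_before x y := ((y.1 < x.1) || ((x.1 == y.1) && (y.2 < x.2)))%N.

Lemma strictly_before_trans : transitive strictly_before.
Proof. by move=> [a b] [a' b'] [a'' b'']; rewrite /strictly_before /=; lia. Qed.

Lemma strictly_before_irr : irreflexive strictly_before.
Proof. by move=> [a b]; rewrite /strictly_before /=; lia. Qed.

Lemma reads_before_trans : transitive reads_before.
Proof. by move=> [a b] [a' b'] [a'' b'']; rewrite /reads_before /=; lia. Qed.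

Lemma reads_before_anti : antisymmetric reads_before.
Proof.
by move=> [a b] [a' b']; rewrite /reads_before /= => h; congr (_, _); lia.
Qed.

Lemma reads_before_total : total reads_before.
Proof. by move=> [a b] [a' b']; rewrite /reads_before /=; lia. Qed.

Section Cells.

Variable lam : nat -> nat.
Implicit Types (x y : nat * nat) (xs L : seq (nat * nat)) (a b : nat).

Definition in_la x := [&& 0 < x.1, 0 < x.2 & x.2 <= lam x.1]%N.

Fixpoint row_cells a b : seq (nat * nat) :=
  if b is b'.+1 then (a, b) :: row_cells a b' else [::].

Fixpoint upper_cells a : seq (nat * nat) :=
  if a is a'.+1 then row_cells a (lam a) ++ upper_cells a' else [::].

Lemma mem_row_cells x a b :
  (x \in row_cells a b) = (x.1 == a) && (0 < x.2 <= b)%N.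
Proof.
case: x => p q; elim: b => [|b IH] /=; first by rewrite in_nil; lia.
by rewrite in_cons IH xpair_eqE /=; lia.
Qed.

Lemma mem_upper_cells x a : (x \in upper_cells a) = in_la x && (x.1 <= a)%N.
Proof.
rewrite /in_la; case: x => p q; elim: a => [|a IH] /=; first by rewrite in_nil; lia.
rewrite mem_cat mem_row_cells IH /=.
by have [->|np] := eqVneq p a.+1; lia.
Qed.

Lemma upper_cells_sorted a : sorted strictly_before (upper_cells a).
Proof.
rewrite sorted_pairwise; last exact: strictly_before_trans.
elim: a => //= a IH; rewrite pairwise_cat IH andbT; apply/andP; split.
  apply/allrelP => x y; rewrite mem_row_cells mem_upper_cells.
  by move=> /andP[/eqP e _] /andP[_ h]; rewrite /strictly_before e ltnS h.
elim: (lam a.+1) => //= b IHb; rewrite IHb andbT; apply/allP => y.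
by rewrite mem_row_cells /strictly_before /=; lia.
Qed.

Lemma upper_cells_uniq a : uniq (upper_cells a).
Proof.
apply: (sorted_uniq strictly_before_trans strictly_before_irr).
exact: upper_cells_sorted.
Qed.

Definition compatible x y := ((y.1 < x.1)%N && ((x.2 < y.2)%N ==> ~~ in_la (x.1, y.2))).

(** Good lists are the admissible sets of cells listed in reading order: [compatible] makes the rows
    strictly decrease and encodes (C2). *)
Definition good xs := all in_la xs && pairwise compatible xs.

Lemma good_rcons xs x :
  good (rcons xs x) = [&& good xs, in_la x & all (compatible^~ x) xs].
Proof.
by rewrite /good all_rcons pairwise_rcons andbACA andbC.
Qed.

Lemma good_catl xs ys : good (xs ++ ys) -> good xs.
Proof. by rewrite /good all_cat pairwise_cat => /andP[/andP[-> _] /and3P[_ -> _]]. Qed.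

Lemma good_in xs x : good xs -> x \in xs -> in_la x.
Proof. by move=> /andP[/allP h _] /h. Qed.

Lemma good_same_row xs x y : good xs -> x \in xs -> y \in xs -> x.1 = y.1 -> x = y.
Proof.
move=> /andP[_]; elim: xs => //= z xs IH /andP[/allP hz /IH{}IH].
rewrite !in_cons => /orP[/eqP->|xin] /orP[/eqP->|yin] //; last exact: IH.
- by have := hz y yin; rewrite /compatible; lia.
- by have := hz x xin; rewrite /compatible; lia.
Qed.

Lemma good_compatible xs x y :
  good xs -> x \in xs -> y \in xs -> (y.1 < x.1)%N -> compatible x y.
Proof.
move=> /andP[_]; elim: xs => //= z xs IH /andP[/allP hz /IH{}IH].
rewrite !in_cons => /orP[/eqP->|xin] /orP[/eqP->|yin]; last exact: IH.
- by rewrite ltnn.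
- by move=> _; exact: hz.
- by have := hz x xin; rewrite /compatible; lia.
Qed.

Lemma sort_good xs : good xs -> sort reads_before [fset x in xs]%fset = xs.
Proof.
move=> /andP[_ hC]; apply: (@sorted_eq _ reads_before).
- exact: reads_before_trans.
- exact: reads_before_anti.
- exact/sort_sorted/reads_before_total.
- rewrite sorted_pairwise; last exact: reads_before_trans.
  apply: sub_pairwise hC => x y /andP[h _]; by rewrite /reads_before h.
rewrite perm_sort; apply: uniq_perm; first exact: fset_uniq.
  by apply: pairwise_uniq hC => x; rewrite /compatible ltnn.
by move=> x; rewrite in_fset.
Qed.

End Cells.

(** * The word of a partition and the deletion of its letters *)

Section PartitionWord.

Variables (k c : nat) (hk : (0 < k)%N) (hc : (c <= k)%N).
Local Notation H := (k.+1 - c)%N.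

Variable lam : nat -> nat.
Hypothesis lam_dec : forall a b, (a <= b)%N -> (lam b <= lam a)%N.
Hypothesis lam_c : forall a, (lam a <= c)%N.
Hypothesis lam_H : forall a, (H < a)%N -> lam a = 0%N.

Implicit Types (x y : nat * nat) (xs L : seq (nat * nat)) (a b : nat).

Local Notation t := (affine_transp k).
Local Notation in_la := (in_la lam).
Local Notation upper_cells := (upper_cells lam).
Local Notation compatible := (compatible lam).
Local Notation good := (good lam).

(* The cell in row a and column b corresponds to the pair of positions        *)
(* (1 - a, b).                                                                *)
Definition cell_transp x : int -> int := t (1 - x.1%:Z) x.2%:Z.

Definition cells_perm xs : int -> int := word_perm (map (residue k) xs).

(** The conjugate partition $\lambda'_b$, truncated to the first $a$ rows. *)
Fixpoint col_len a b : nat :=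
  if a is a'.+1 then (col_len a' b + (b <= lam a))%N else 0%N.

Lemma cells_perm_cat xs ys v :
  cells_perm (xs ++ ys) v = cells_perm xs (cells_perm ys v).
Proof. by rewrite /cells_perm map_cat word_perm_cat. Qed.

Lemma cells_perm_cons x xs v :
  cells_perm (x :: xs) v = t (x.2%:Z - x.1%:Z) (x.2%:Z - x.1%:Z + 1) (cells_perm xs v).
Proof.
rewrite /cells_perm /= (@simple_reflE k hk _ (x.2%:Z - x.1%:Z)) //.
by rewrite rmorphB /= -!pmulrn.
Qed.

(** The word of a row is $s_{b-a}\cdots s_{1-a}$, a cycle on consecutive integers. *)
Lemma row_cells_act a b (v : int) : (0 < a <= H)%N -> (b <= c)%N ->
  v \in window k c -> cells_perm (row_cells a b) v =
    if v == 1 - a%:Z then b%:Z + 1 - a%:Z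
    else if 1 - a%:Z < v <= b%:Z + 1 - a%:Z then v - 1 else v.
Proof.
move=> ha + hv; elim: b => [|b IH] hb.
  by rewrite /cells_perm /=; case: eqP => [->|]; [|case: ifP]; lia.
rewrite cells_perm_cons (IH (ltnW hb)) /=; move: hv; rewrite mem_window => hv.
set v' := (X in t _ _ X).
have hv' : v' \in window k c.
  by rewrite mem_window /v'; case: eqP => _; [|case: ifP => ?]; lia.
have h1 : b.+1%:Z - a%:Z \in window k c by rewrite mem_window; lia.
have h2 : b.+1%:Z - a%:Z + 1 \in window k c by rewrite mem_window; lia.
rewrite (transp_window h1 h2 hv') /v'.
case: (eqVneq v (1 - a%:Z)) => [e|ne]; first by do 2?case: ifP => ?; lia.
by case: (boolP (1 - a%:Z < v <= b%:Z + 1 - a%:Z)) => ?; do 3?case: ifP => ?; lia.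
Qed.

Lemma col_len_le_row a b : (col_len a b <= a)%N.
Proof. by elim: a => //= a IH; lia. Qed.

Lemma col_len_full a b : (b <= lam a)%N -> col_len a b = a.
Proof.
elim: a => //= a IH h; rewrite h addn1 IH //.
by apply: leq_trans h _; apply: lam_dec.
Qed.

Lemma col_len_le a b p : (lam a.+1 < b)%N -> (col_len p b <= a)%N.
Proof.
move=> h; elim: p => //= p IH.
have [hb|hb] := leqP b (lam p.+1); last by rewrite addn0.
have : (p.+1 <= a)%N.
  by rewrite leqNgt; apply/negP => /lam_dec; lia.
by have := col_len_le_row p b; lia.
Qed.

Lemma col_len_ge a b p : (b <= lam a)%N -> (a <= p)%N -> (a <= col_len p b)%N.
Proof.
move=> h /subnK <-; elim: (p - a)%N => [|d IH] /=; first by rewrite col_len_full.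
by apply: leq_trans IH _; rewrite leq_addr.
Qed.

Lemma col_len_dec a b b' : (b <= b')%N -> (col_len a b' <= col_len a b)%N.
Proof. by move=> h; elim: a => //= a IH; lia. Qed.

(** The cycle of row $a$ lowers the current value at $b$ by one exactly when the row meets column
    $b$. *)
Lemma upper_cells_pos a b : (a <= H)%N -> (0 < b <= c)%N ->
  cells_perm (upper_cells a) b%:Z = b%:Z - (col_len a b)%:Z.
Proof.
move=> + hb; elim: a => [|a IH] ha; first by rewrite /cells_perm /= subr0.
have le_a := col_len_le_row a b.
rewrite cells_perm_cat (IH (ltnW ha)) row_cells_act ?mem_window //=; last by lia.
have [h|h] := leqP b (lam a.+1).
  rewrite col_len_full; last by apply: leq_trans h _; apply: lam_dec.
  by do 2?case: ifP => ?; lia.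
by do 2?case: ifP => ?; lia.
Qed.

Lemma upper_cells_neg a p : (a <= H)%N -> (0 < p <= H)%N ->
  cells_perm (upper_cells a) (1 - p%:Z) =
    if (p <= a)%N then (lam p)%:Z + 1 - p%:Z else 1 - p%:Z.
Proof.
move=> + hp; elim: a => [|a IH] ha; first by rewrite /cells_perm /= ifF //; lia.
have lc := lam_c p; rewrite cells_perm_cat (IH (ltnW ha)) row_cells_act ?mem_window //=.
- have [le_pa|lt_ap] := leqP p a.
    by have := lam_dec (leqW le_pa); do 3?case: ifP => ?; lia.
  by have [->|np] := eqVneq p a.+1; do 3?case: ifP => ?; lia.
- by case: ifP; lia.
Qed.

Lemma cell_window x : in_la x -> (1 - x.1%:Z \in window k c) /\ (x.2%:Z \in window k c).
Proof.
case: x => a b /and3P[/= a0 b0 ba]; have := lam_c a.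
have : (a <= H)%N by rewrite leqNgt; apply/negP => /lam_H; lia.
by rewrite !mem_window; lia.
Qed.

(* Deleting the letter of x from the word of x :: L amounts to multiplying on *)
(* the right by a reflection which does not depend on the letters before x.   *)
Fixpoint deletable L : Prop :=
  if L is x :: L' then
    cells_perm (x :: L') \o cell_transp x = cells_perm L' /\ deletable L'
  else True.

(** The word read after the cell $(a,b)$ sends $1-a$ and $b$ to $b-a$ and $b-a+1$, the two values
    exchanged by the letter of that cell. Conjugation thus turns $t_{1-a,b}$ into this letter, which
    cancels. *)
Lemma upper_cells_deletable a : (a <= H)%N -> deletable (upper_cells a).
Proof.
elim: a => //= a IH ha; have {}IH := IH (ltnW ha).
suff gen b : (b <= lam a.+1)%N -> deletable (row_cells a.+1 b ++ upper_cells a).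
  exact: gen.
elim: b => //= b IHb hb; split; last exact/IHb/ltnW.
have hx : in_la (a.+1, b.+1) by rewrite /in_la.
have [w1 w2] := cell_window hx; have lc := lam_c a.+1.
set L := row_cells _ _ ++ _.
have pL : pinj k (cells_perm L) by exact: pinj_word.
have nij : (1 - a.+1%:Z != b.+1%:Z %[mod k.+1%:Z])%Z.
  by rewrite (window_cong w1 w2) /=; lia.
have e1 : cells_perm L (1 - a.+1%:Z) = b.+1%:Z - a.+1%:Z.
  rewrite cells_perm_cat (upper_cells_neg (ltnW ha)) // ltnn row_cells_act //.
    by rewrite ifT; lia.
  lia.
have e2 : cells_perm L b.+1%:Z = b.+1%:Z - a.+1%:Z + 1.
  rewrite cells_perm_cat upper_cells_pos //; [|lia|lia].
  rewrite col_len_full; last by apply: leq_trans hb _; apply: lam_dec.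
  rewrite row_cells_act //; [do 2?case: ifP => ?; lia|lia|rewrite mem_window; lia].
apply: funext => v; rewrite /= cells_perm_cons /cell_transp transp_conjE //= e1 e2.
by rewrite transpK // cong_succF.
Qed.

(** Cells are deleted in reading order, which leaves the word after each later cell intact, so its
    reflection is still the right one. *)
Lemma cells_perm_delete L xs : deletable L -> uniq L -> subseq xs L ->
  cells_perm [seq x <- L | x \notin xs] =
  foldl (fun w x => w \o cell_transp x) (cells_perm L) xs.
Proof.
elim: L xs => [|y L IH] xs; first by move=> _ _; rewrite subseq0 => /eqP ->.
move=> /= [dy dL] /andP[yL uL]; case: xs => [|x xs] /=.
  by move=> _; rewrite filter_predT.
have foldl_left (g v : int -> int) (zs : seq (nat * nat)) :
    foldl (fun w x => w \o cell_transp x) (g \o v) zs =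
    g \o foldl (fun w x => w \o cell_transp x) v zs.
  by elim: zs v => //= z zs IHz v; rewrite -IHz.
case: eqP => [-> sub|_ sub].
  rewrite mem_head /= dy -IH //; congr cells_perm; apply: eq_in_filter => z zL.
  by rewrite in_cons; case: eqP => // ez; rewrite -ez zL in yL.
have yx : y \notin x :: xs by apply: contra yL => /(mem_subseq sub).
have := IH (x :: xs) dL uL sub; rewrite yx /= => e.
have -> (zs : seq (nat * nat)) :
  cells_perm (y :: zs) = simple_refl (residue k y) \o cells_perm zs by [].
by rewrite e -foldl_left.
Qed.

(** * Values and inversions of $w_\lambda$ *)

Definition wla : int -> int := cells_perm (upper_cells H).

Lemma wla_cell a b : (0 < a <= H)%N -> (0 < b <= c)%N ->
  (wla b%:Z < wla (1 - a%:Z)) = (b <= lam a)%N.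
Proof.
move=> ha hb; rewrite /wla upper_cells_pos // upper_cells_neg // ifT; last by lia.
have [h|h] := leqP b (lam a).
  by have := col_len_ge h (p := H); lia.
by case: a ha h => // a ha h; have := @col_len_le a b H h; lia.
Qed.

Lemma wla_neg_mono a a' : (0 < a)%N -> (a < a' <= H)%N ->
  wla (1 - a'%:Z) < wla (1 - a%:Z).
Proof.
move=> ha ha'; rewrite /wla !upper_cells_neg //; try lia.
rewrite !ifT; try lia.
by have := @lam_dec a a'; lia.
Qed.

Lemma wla_pos_mono b b' : (0 < b)%N -> (b < b' <= c)%N -> wla b%:Z < wla b'%:Z.
Proof.
move=> hb hb'; rewrite /wla !upper_cells_pos //; try lia.
by have := @col_len_dec H b b'; lia.
Qed.

Lemma wla_stable : stable c wla.
Proof.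
rewrite /wla; have : all in_la (upper_cells H).
  by apply/allP => x; rewrite mem_upper_cells => /andP[].
elim: (upper_cells H) => [|x L IH] /=; first by move=> _ z.
case/andP=> hx /IH sL z; move: (hx) => /cell_window; rewrite !mem_window.
move: hx => /and3P[? ? ?] ?.
rewrite cells_perm_cons (stable_transp (k := k) (c := c)) ?sL // mem_window; lia.
Qed.

Lemma size_inversions_wla :
  (size (upper_cells H) <= size (inversions k c wla))%N.
Proof.
rewrite -(size_map (fun x => (1 - x.1%:Z, x.2%:Z))).
apply: uniq_leq_size.
  rewrite map_inj_uniq ?upper_cells_uniq // => -[a b] [a' b'] /= [e1 e2].
  by congr (_, _); lia.
move=> _ /mapP[x + ->]; rewrite mem_upper_cells => /andP[hx hH].
have [w1 w2] := cell_window hx; rewrite mem_inversions w1 w2 /=.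
case/and3P: hx => x1 x2 x3; rewrite wla_cell ?x3 ?x1 ?x2 //; first by lia.
by rewrite (leq_trans x3).
Qed.

(** * Permutations reached by deleting admissible cells *)

Definition wdel xs : int -> int := foldl (fun w x => w \o cell_transp x) wla xs.

Lemma in_la_bounds x : in_la x ->
  [/\ (0 < x.1)%N, (x.1 <= H)%N, (0 < x.2)%N & (x.2 <= c)%N].
Proof.
case: x => a b /and3P[/= a0 b0 ba]; split => //; last exact: leq_trans ba _.
by rewrite leqNgt; apply/negP => /lam_H; lia.
Qed.

Lemma in_la_wla x : (0 < x.1 <= H)%N -> (0 < x.2 <= c)%N ->
  in_la x = (wla x.2%:Z < wla (1 - x.1%:Z)).
Proof. by move=> h1 h2; rewrite wla_cell // /in_la; lia. Qed.

Lemma in_la_up a a' b : (0 < a <= a')%N -> in_la (a', b) -> in_la (a, b).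
Proof.
rewrite /in_la /= => /andP[-> /lam_dec h] /and3P[_ -> h'] /=.
exact: leq_trans h' h.
Qed.

Lemma wla_neg_le a a' : (0 < a)%N -> (a <= a' <= H)%N ->
  wla (1 - a'%:Z) <= wla (1 - a%:Z).
Proof.
move=> a0 /andP[]; rewrite leq_eqVlt => /orP[/eqP-> //|lt_a ha'].
by apply/ltW/wla_neg_mono; rewrite ?lt_a.
Qed.

(* The values of the permutation w reached after the cells xs, as far as the   *)
(* next edge depends on them: rows above all cells of xs are untouched, and a  *)
(* column used by xs carries the label of the last cell of xs in it.           *)
Record state xs w : Prop := State {
  state_word : has_word k w;
  state_affine : affine_perm k w;
  state_stable : stable c w;
  state_neg_le : forall a, (0 < a <= H)%N -> w (1 - a%:Z) <= wla (1 - a%:Z);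
  state_neg : forall a, (0 < a <= H)%N -> (forall x, x \in xs -> (a < x.1)%N) ->
    w (1 - a%:Z) = wla (1 - a%:Z);
  state_pos : forall b, (0 < b <= c)%N ->
    (w b%:Z = wla b%:Z /\ forall a, (a, b) \notin xs) \/
    (exists2 a, (a, b) \in xs & w b%:Z = wla (1 - a%:Z) /\
       forall a', (a', b) \in xs -> (a <= a')%N);
  state_inv : (size (upper_cells H) <= size (inversions k c w) + size xs)%N;
  state_len : (coxeter_length k w + size xs <= size (upper_cells H))%N }.

(** The bounds [state_inv] and [state_len] meet, because inversions in the window number at most the
    length. *)
Lemma state_length xs w : state xs w ->
  (coxeter_length k w + size xs)%N = size (upper_cells H).
Proof.
move=> s; apply/eqP; rewrite eqn_leq (state_len s) /=.
apply: leq_trans (state_inv s) _; rewrite leq_add2r.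
exact: (size_inversions_le _ hk) (state_word s).
Qed.

Lemma state_nil : state [::] wla.
Proof.
have hw : has_word k wla by exists (map (residue k) (upper_cells H)).
split=> //.
- exact: affine_perm_word.
- exact: wla_stable.
- by move=> b hb; left.
- by rewrite addn0 size_inversions_wla.
- by rewrite addn0 -(size_map (residue k)); exact: coxeter_length_le.
Qed.

Lemma state_pos_ge xs w b : good xs -> state xs w -> (0 < b <= c)%N ->
  wla b%:Z <= w b%:Z.
Proof.
move=> g s hb; case: (state_pos s hb) => [[-> _] //|[a ab [-> _]]].
have hab := good_in g ab; have [] := in_la_bounds hab => /= ? ? ? ?.
by apply: ltW; rewrite -(@in_la_wla (a, b)) //=; lia.
Qed.

Lemma state_step_gap xs w x : state xs w -> good (rcons xs x) ->
  [/\ w (1 - x.1%:Z) = wla (1 - x.1%:Z), w x.2%:Z < w (1 - x.1%:Z)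
    & forall m : int, 1 - x.1%:Z < m < x.2%:Z ->
        ~~ (w x.2%:Z < w m < w (1 - x.1%:Z))].
Proof.
case: x => a b s; rewrite good_rcons => /and3P[g hx /allP hC] /=.
have [/= a0 aH b0 bc] := in_la_bounds hx.
have hlt y : y \in xs -> (a < y.1)%N by move=> /hC /andP[].
have wi : w (1 - a%:Z) = wla (1 - a%:Z) by apply: (state_neg s); rewrite ?a0.
have ge_b : wla b%:Z <= w b%:Z by apply: (state_pos_ge g s); rewrite b0.
split=> //.
  rewrite wi; case: (@state_pos _ _ s b) => [|[-> _]|[a' ab [-> _]]]; first by lia.
    by rewrite -(@in_la_wla (a, b)) //=; lia.
  have [/= ? ? ? ?] := in_la_bounds (good_in g ab).
  by have /= ? := hlt _ ab; apply: wla_neg_mono => //; lia.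
move=> m hm; have [m0|m0] := leP m 0.
  have em : m = 1 - (absz (1 - m)%R)%:Z by lia.
  rewrite em wi (state_neg s); [|lia|by move=> y /hlt; lia].
  suff : wla (1 - a%:Z) < wla (1 - (absz (1 - m)%R)%:Z) by lia.
  by apply: wla_neg_mono; lia.
have em : m = (absz m)%:Z by lia.
have [|[wm _]|[a' am [wm _]]] := @state_pos _ _ s (absz m); first by lia.
  suff h : wla (absz m)%:Z < wla b%:Z.
    by rewrite em wm negb_and -leNgt (le_trans (ltW h) ge_b).
  by apply: wla_pos_mono; lia.
have [/= ? ? ? ?] := in_la_bounds (good_in g am).
have /andP[/= _ /implyP C2] := hC _ am.
suff h : wla (1 - a'%:Z) <= wla b%:Z.
  by rewrite em wm negb_and -leNgt (le_trans h ge_b).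
by rewrite leNgt -(@in_la_wla (a', b)) /=; [apply: C2|..]; lia.
Qed.

Lemma state_step xs w x : state xs w -> good (rcons xs x) ->
  state (rcons xs x) (w \o cell_transp x).
Proof.
move=> s gx; have [wi wji gap] := state_step_gap s gx.
move: gx; rewrite good_rcons => /and3P[g hx /allP hC].
case: x hx hC wi wji gap => a b hx hC /= wi wji gap.
have hlt y : y \in xs -> (a < y.1)%N by move=> /hC /andP[].
have [/= a0 aH b0 bc] := in_la_bounds hx; have [/= w1 w2] := cell_window hx.
have ij : 1 - a%:Z < b%:Z by lia.
have nij : (1 - a%:Z != b%:Z %[mod k.+1%:Z])%Z by rewrite (window_cong w1 w2); lia.
have [hw' len'] := transp_down hk (state_word s) ij wji.
have tE := transp_window w1 w2; rewrite /cell_transp /=; split => //=.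
- exact: affine_perm_transp (state_affine s) nij.
- exact: stable_comp (state_stable s) (stable_transp w1 w2).
- move=> p hp; rewrite tE ?mem_window; last by lia.
  case: eqP => [ep|_]; first by rewrite ep -wi ltW.
  by rewrite ifF; [exact: (state_neg_le s)|lia].
- move=> p hp hlt'; have := hlt' (a, b); rewrite mem_rcons mem_head => /(_ isT) /= pa.
  rewrite tE ?mem_window; last by lia.
  rewrite ifF; last by lia.
  rewrite ifF; last by lia.
  by apply: (state_neg s) => // y hy; apply: hlt'; rewrite mem_rcons in_cons hy orbT.
- move=> q hq; rewrite tE ?mem_window; last by lia.
  rewrite ifF; last by lia.
  case: eqP => [eq|nq].
    right; exists a; first by rewrite mem_rcons in_cons (_ : q = b) ?eqxx //; lia.
    split=> // a'; rewrite mem_rcons in_cons => /orP[/eqP[-> _] //|/hlt/= h].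
    exact: ltnW.
  have ne a' : ((a', q) \in rcons xs (a, b)) = ((a', q) \in xs).
    rewrite mem_rcons in_cons xpair_eqE.
    by case: (q =P b) => [e|_]; [rewrite e in nq|rewrite andbF].
  case: (state_pos s hq) => [[-> h]|[a' h1 [-> h2]]]; [left|right].
    by split=> // a'; rewrite ne.
  exists a'; first by rewrite ne.
  by split=> // a''; rewrite ne; exact: h2.
- rewrite size_rcons; have := state_inv s.
  have [iw _] := has_word_pinj hk (state_word s).
  by have := size_inversions_cover iw w1 w2 ij gap; lia.
- by rewrite size_rcons; have := state_len s; lia.
Qed.

Lemma wdel_rcons xs x : wdel (rcons xs x) = wdel xs \o cell_transp x.
Proof. by rewrite /wdel -cats1 foldl_cat. Qed.

Lemma good_state xs : good xs -> state xs (wdel xs).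
Proof.
elim/last_ind: xs => [_|xs x IH gx]; first exact: state_nil.
rewrite wdel_rcons; apply: state_step => //; apply: IH.
by move: gx; rewrite good_rcons => /and3P[].
Qed.

(** * Marked edges and increasing paths *)

Lemma good_edge xs x : good (rcons xs x) ->
  let e := (wdel (rcons xs x), (1 - x.1%:Z, x.2%:Z)) in
  marked_edge k (wdel xs) e /\ edge_label e = wla (1 - x.1%:Z).
Proof.
move=> gx; have s' := good_state gx.
have /and3P[g hx _] : [&& good xs, in_la x & all (compatible^~ x) xs].
  by rewrite -good_rcons.
have s := good_state g; have [wi _ _] := state_step_gap s gx.
have [a0 aH b0 bc] := in_la_bounds hx; have [w1 w2] := cell_window hx.
have nij : (1 - x.1%:Z != x.2%:Z %[mod k.+1%:Z])%Z by rewrite (window_cong w1 w2); lia.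
split; last by rewrite /edge_label /= wdel_rcons /= /cell_transp transp_r0.
split=> //; first by split; [exact: state_affine s|exact: state_affine s'].
- by have := state_length s; have := state_length s'; rewrite size_rcons; lia.
- by lia.
- by rewrite wdel_rcons; apply: funext => m; rewrite /= /cell_transp transpK.
Qed.

(** The exact length drop excludes intermediate values, and a label larger than all earlier ones
    puts the new cell above all earlier rows; a failure of (C2) would then produce an intermediate
    value. *)
Lemma edge_good xs (y : int -> int) (i j : int) : good xs ->
  marked_edge k (wdel xs) (y, (i, j)) ->
  (forall x, x \in xs -> wla (1 - x.1%:Z) < y j) ->
  exists x, [/\ good (rcons xs x), y = wdel (rcons xs x), i = 1 - x.1%:Z & j = x.2%:Z].
Proof.
move=> g [_ len [i0 j0] nij yx] lab; have s := good_state g.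
set w := wdel xs in s len yx *.
have ij : i < j by lia.
have yE : y = w \o t i j.
  by rewrite -yx; apply: funext => m /=; rewrite transpK.
have wji := length_drop_desc hk (state_word s) ij nij yx len.
have [w1 w2] := stable_inversion hc (has_word_pinj hk (state_word s))
  (state_stable s) i0 j0 wji.
have gap (m : int) : i < m < j -> ~~ (w j < w m < w i).
  move=> hm; apply/negP => hwm.
  by have := length_cover_gap hk (state_word s) w1 w2 hm hwm; rewrite -yE len; lia.
rewrite !mem_window in w1 w2.
pose a := absz (1 - i)%R; pose b := absz j.
have ei : i = 1 - a%:Z by lia.
have ej : j = b%:Z by lia.
have ha : (0 < a <= H)%N by lia.
have hb : (0 < b <= c)%N by lia.
rewrite yE /= transp_r0 // in lab.
(* The label is $w(1-a)\le w_\lambda(1-a)$, and $w_\lambda(1-a)$ decreases with $a$: a row at or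
   below that of $x$ would give too small a label. *)
have hlt x : x \in xs -> (a < x.1)%N.
  move=> hx; have [? ? _ _] := in_la_bounds (good_in g hx).
  rewrite ltnNge; apply/negP => le_xa.
  have := lab x hx; rewrite ltNge => /negP; apply; rewrite ei.
  by apply: le_trans (state_neg_le s ha) _; apply: wla_neg_le => //; lia.
have wi : w (1 - a%:Z) = wla (1 - a%:Z) := state_neg s ha hlt.
rewrite ei ej in wji gap.
have hab : in_la (a, b).
  case: (state_pos s hb) => [[wb _]|[a' ab _]].
    by rewrite in_la_wla //= -wb -wi.
  by apply: in_la_up (good_in g ab); have := hlt _ ab => /=; lia.
exists (a, b); split=> //; last by rewrite wdel_rcons yE /cell_transp /= -ei -ej.
rewrite good_rcons g hab /=; apply/allP => -[a' b'] hx'.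
have hx := good_in g hx'; have [/= ? ? ? ?] := in_la_bounds hx.
have /= lt_a := hlt _ hx'.
rewrite /compatible /= lt_a /=; apply/implyP => lt_b; apply/negP => ha'b.
have [|[_ /(_ a')]|[a2 h2 [wb' min2]]] := @state_pos _ _ s b'; [by lia|by rewrite hx'|].
have le2 := min2 _ hx'; have /= lt2 := hlt _ h2.
have [/= ? ? _ _] := in_la_bounds (good_in g h2).
have wb'i : w b'%:Z < w (1 - a%:Z) by rewrite wb' wi; apply: wla_neg_mono; lia.
(* Position $b'$ lies between $1-a$ and $b$, so this inequality contradicts the gap. It could fail
   only if column $b$ was last used in a row $a_3\le a_2$; then $a_3=a_2$ repeats a row, and
   $a_3<a_2$ violates (C2) inside [xs]. *)
suff : w b%:Z < w b'%:Z.
  by have := gap b'%:Z; rewrite wb'i andbT => gap' ?; move: gap'; lia.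
case: (state_pos s hb) => [[wb _]|[a3 h3 [wb _]]].
  rewrite wb wb'; apply: (@lt_le_trans _ _ (wla (1 - a'%:Z))).
    by rewrite -(@in_la_wla (a', b)) //=; lia.
  by apply: wla_neg_le; lia.
have [/= ? ? _ _] := in_la_bounds (good_in g h3).
rewrite wb wb'; have [lt3|le3] := ltnP a2 a3; first by apply: wla_neg_mono; lia.
have [e3|ne3] := eqVneq a3 a2.
  by have := good_same_row g h3 h2 e3; case; lia.
have lt32 : ((a3, b).1 < (a2, b').1)%N by rewrite /=; lia.
have /andP[_ /implyP/(_ lt_b)/negP[]] := good_compatible g h2 h3 lt32.
by apply: in_la_up ha'b => /=; lia.
Qed.

Fixpoint cell_path w xs : seq marked_step :=
  if xs is x :: xs' then
    (w \o cell_transp x, (1 - x.1%:Z, x.2%:Z)) :: cell_path (w \o cell_transp x) xs'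
  else [::].

Lemma good_labels xs : good xs ->
  pairwise <%R [seq wla (1 - x.1%:Z) | x <- xs].
Proof.
move=> g; have /andP[/allP hin] := g; rewrite pairwise_map.
elim: xs {g} hin => //= x xs IH hin /andP[/allP hx hp].
apply/andP; split; last by apply: IH => // y hy; apply: hin; rewrite in_cons hy orbT.
apply/allP => y hy; have [? ? _ _] := in_la_bounds (hin x (mem_head _ _)).
have [|? ? _ _] := @in_la_bounds y; first by apply: hin; rewrite in_cons hy orbT.
by have /andP[? _] := hx y hy; apply: wla_neg_mono; lia.
Qed.

(** The prefix [ys] makes the induction work: prepending its labels lets the next label be compared
    with all earlier ones, as [edge_good] requires. *)
Lemma marked_path_good ys (p : seq marked_step) : good ys ->
  (marked_path k (wdel ys) p /\
   pairwise <%R ([seq wla (1 - x.1%:Z) | x <- ys] ++ map edge_label p)) <->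
  exists2 xs, good (ys ++ xs) & p = cell_path (wdel ys) xs.
Proof.
elim: p ys => [|e p IH] ys g; split.
- by move=> _; exists [::]; rewrite ?cats0.
- by move=> _; rewrite cats0 good_labels.
- case: e => y [i j] /= [[he hp] hpw].
  have hlab x : x \in ys -> wla (1 - x.1%:Z) < y j.
    move=> hx; move: hpw; rewrite pairwise_cat => /and3P[/allrelP h _ _].
    by apply: (h _ (edge_label (y, (i, j)))); [exact: map_f|exact: mem_head].
  have [x [gx ey ei ej]] := edge_good g he hlab.
  have [_ elab] := good_edge gx.
  have [|xs gxs ep] := (IH _ gx).1.
    rewrite -ey; split=> //; rewrite map_rcons cat_rcons -elab -ey -ei -ej.
    exact: hpw.
  exists (x :: xs); first by rewrite -cat_rcons.
  by rewrite /= -ei -ej ep wdel_rcons -wdel_rcons -ey.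
- case=> -[|x xs] //; rewrite -cat_rcons => gxs [-> ep].
  have gx := good_catl gxs; have [he elab] := good_edge gx.
  rewrite -wdel_rcons in ep *.
  have [|hp hpw] := (IH _ gx).2; first by exists xs.
  split; first by split.
  by move: hpw; rewrite map_rcons cat_rcons -elab.
Qed.

Lemma increasing_pathsP n (p : seq marked_step) :
  increasing_paths k n wla p <->
  exists2 xs, good xs /\ size xs = n & p = cell_path wla xs.
Proof.
have szE w xs : size (cell_path w xs) = size xs.
  by elim: xs w => //= x xs IH w; rewrite IH.
have := @marked_path_good [::] p isT; rewrite /= -[wdel [::]]/wla => -[h1 h2].
split.
  move=> [sz mp]; rewrite sorted_pairwise; last exact: lt_trans.
  move=> hs; have [|xs g e] := h1; first by split.
  by exists xs => //; split=> //; rewrite -sz e szE.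
move=> [xs [g sz] e]; have [|mp hp] := h2; first by exists xs.
by split=> //; [rewrite e szE|rewrite sorted_pairwise //; exact: lt_trans].
Qed.

Lemma path_end_cell_path xs : path_end wla (cell_path wla xs) = wdel xs.
Proof.
rewrite /path_end /wdel; by elim: xs (wla) => //=.
Qed.

Lemma cell_path_inj w : injective (cell_path w).
Proof.
move=> xs; elim: xs w => [|x xs IH] w [|y ys] //= [_ e1 e2 e3].
have exy : x = y by case: x y e1 e2 {e3} => [a b] [a' b'] /= ? ?; congr (_, _); lia.
by rewrite exy in e3 *; rewrite (IH _ _ e3).
Qed.

(** * Reduced words of the remaining cells, and sets of cells as sorted lists *)

Lemma wdel_reduced xs : good xs -> subseq xs (upper_cells H) ->
  let L := [seq x <- upper_cells H | x \notin xs] in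
  cells_perm L = wdel xs /\ reduced (map (residue k) L).
Proof.
move=> g sub L; have e : cells_perm L = wdel xs.
  apply: cells_perm_delete => //; last exact: upper_cells_uniq.
  exact: upper_cells_deletable.
split=> //; apply: length_reduced => //; rewrite -[word_perm _]/(cells_perm L) e.
have := state_length (good_state g).
have szL : (size L + size xs = size (upper_cells H))%N.
  have exs : xs = [seq x <- upper_cells H | x \in xs].
    exact/(subseq_uniqP (upper_cells_uniq _ _)).
  by rewrite (congr1 size exs) !size_filter addnC (count_predC (mem xs)).
by move=> sl; rewrite size_map -(leq_add2r (size xs)) szL sl.
Qed.

Lemma sort_cells (X : {fset nat * nat}) : (forall x, x \in X -> in_la x) ->
  sort reads_before X = [seq x <- upper_cells H | x \in X].
Proof.
move=> hX; apply: (@sorted_eq _ reads_before).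
- exact: reads_before_trans.
- exact: reads_before_anti.
- exact/sort_sorted/reads_before_total.
- apply: (sub_sorted (e := strictly_before)).
    by move=> [a b] [a' b']; rewrite /reads_before /strictly_before /=; lia.
  by apply: sorted_filter (upper_cells_sorted _ _); exact: strictly_before_trans.
rewrite perm_sort.
apply: uniq_perm; rewrite ?fset_uniq ?filter_uniq ?upper_cells_uniq //.
move=> x; rewrite mem_filter mem_upper_cells.
have [xX|//] := boolP (x \in X); rewrite (hX _ xX) /=.
by have [_ -> _ _] := in_la_bounds (hX _ xX).
Qed.

Lemma good_sort (X : {fset nat * nat}) : (forall x, x \in X -> in_la x) ->
  good (sort reads_before X) <-> distinct_rows X /\
  forall x y, x \in X -> y \in X ->
    (y.1 < x.1)%N -> (x.2 < y.2)%N -> ~~ in_la (x.1, y.2).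
Proof.
move=> hX; split=> [g|[hrow hC2]].
  split=> x y; rewrite -(mem_sort reads_before) -(mem_sort reads_before X y) => xX yX.
    exact: good_same_row g xX yX.
  by move=> lt_yx; have /andP[_ /implyP] := good_compatible g xX yX lt_yx.
rewrite /good; apply/andP; split.
  by apply/allP => x; rewrite mem_sort; exact: hX.
apply: (@sub_in_pairwise _ (mem X) strictly_before); last first.
- rewrite sort_cells // -sorted_pairwise; last exact: strictly_before_trans.
  by apply: sorted_filter (upper_cells_sorted _ _); exact: strictly_before_trans.
- by apply/allP => x; rewrite mem_sort.
move=> x y xX yX; rewrite /strictly_before /compatible => /orP[lt_yx|/andP[/eqP e]].
  by rewrite lt_yx /=; apply/implyP; exact: hC2.
by rewrite (hrow x y) // ltnn.
Qed.

End PartitionWord.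

(** * From row-length functions back to partitions and their diagrams *)

Lemma mem_diagram (la : seq nat) x :
  (x \in diagram la) = in_la (fun a => nth 0%N la a.-1) x.
Proof.
rewrite /diagram in_fset /in_la; case: x => a b.
apply/allpairsPdep/and3P => [[a' [b' [+ + [-> ->]]]]|/= [a0 b0 hb]].
  by rewrite !mem_iota /=.
exists a.-1, b.-1; rewrite !mem_iota !prednK //=; split=> //.
by rewrite leqNgt; apply/negP => h; move: hb; rewrite nth_default; lia.
Qed.

Lemma partition_nth_dec (la : seq nat) : is_partition la ->
  forall a b, (a <= b)%N -> (nth 0%N la b.-1 <= nth 0%N la a.-1)%N.
Proof.
move=> /andP[hs _] a b ab; have [hb|hb] := ltnP b.-1 (size la); last first.
  by rewrite nth_default.
have geq_trans : transitive geq by move=> x y z h1 h2; exact: leq_trans h2 h1.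
apply: (sorted_leq_nth geq_trans (fun x => leqnn x) 0%N hs); rewrite ?inE //; lia.
Qed.

Theorem theorem4p18 (K : comNzRingType) (k c n : nat)
    (A : algType K) (u : 'Z_k.+1 -> A) (D : {linear A -> A}) (la : seq nat)
    (hk : (0 < k)%N) (hc : (c <= k)%N) (hn : (1 <= n)%N)
    (hA : is_nilCoxeter u) (hD : is_D1n u n D)
    (hla : is_partition la)
    (hR : (diagram la `<=` diagram (nseq (k.+1 - c) c))%fset) :
  D (u_perm u (w_diag k (diagram la))) =
    \sum_(X <- fpowerset (diagram la) |
            [&& #|` X| == n, `[< distinct_rows X >] & `[< cond_C2 la X >] ])
       u_diag u (diagram la `\` X)%fset.
Proof.
(* Rows are numbered from 1, so [lam 0] repeats [lam 1]; this keeps [lam] weakly decreasing and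
   explains [maxn a 1] below. *)
set lam := fun a => nth 0%N la a.-1; set H := (k.+1 - c)%N.
have lam_dec : forall a b, (a <= b)%N -> (lam b <= lam a)%N by exact: partition_nth_dec.
have memla x : (x \in diagram la) = in_la lam x by exact: mem_diagram.
have lam_pos a : (0 < lam a)%N -> (lam a <= c)%N && (a <= H)%N.
  move=> h; have : (maxn a 1, lam a) \in diagram (nseq H c).
    apply: (fsubsetP hR); rewrite memla /in_la h /=; have -> : (0 < maxn a 1)%N by lia.
    by case: a h => [|a] h //=; rewrite (maxn_idPl _).
  rewrite mem_diagram /in_la /= nth_nseq => /and3P[_ _].
  by case: ifP => h1 h2; move: h h1 h2; rewrite -/lam; move: (lam a) => l; lia.
have lam_c a : (lam a <= c)%N.
  by case: (posnP (lam a)) => [->//|/lam_pos/andP[]].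
have lam_H a : (H < a)%N -> lam a = 0%N.
  by case: (posnP (lam a)) => [->//|/lam_pos/andP[_]]; lia.
have hsort := sort_cells hk hc lam_c lam_H.
have readE (X : {fset nat * nat}) :
    sort reads_before (diagram la `\` X)%fset =
    [seq x <- upper_cells lam H | x \notin X].
  rewrite hsort; last by move=> x; rewrite in_fsetD memla => /andP[].
  apply: eq_in_filter => x; rewrite mem_upper_cells in_fsetD memla.
  by move=> /andP[-> _]; rewrite andbT.
have wlaE : w_diag k (diagram la) = wla k c lam.
  have := readE fset0; rewrite fsetD0 /w_diag /reading_word => ->.
  by rewrite filter_predT.
pose F (X : {fset nat * nat}) := cell_path k (wla k c lam) (sort reads_before X).
pose r : seq {fset nat * nat} := [seq X <- fpowerset (diagram la) |
            [&& #|` X| == n, `[< distinct_rows X >] & `[< cond_C2 la X >] ]].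
have subP (X : {fset nat * nat}) : (X `<=` diagram la)%fset ->
    forall x, x \in X -> in_la lam x.
  by move=> /fsubsetP h x /h; rewrite memla.
have rP (X : {fset nat * nat}) : X \in r <->
    [/\ (X `<=` diagram la)%fset, good lam (sort reads_before X)
      & size (sort reads_before X) = n].
  rewrite mem_filter fpowersetE size_sort cardfE; split.
    case/andP=> /and3P[/eqP hX /asboolP h1 /asboolP h2] sX; split=> //.
    apply/(good_sort hk hc lam_c lam_H (subP _ sX)); split=> // x y xX yX h h'.
    by rewrite -memla; exact: h2.
  case=> sX /(good_sort hk hc lam_c lam_H (subP _ sX))[h1 h2] hX.
  rewrite sX hX eqxx andbT /=; apply/andP; split; apply/asboolP => //.
  by move=> x y xX yX h h'; rewrite memla; exact: h2.
have F_inj : {in r &, injective F}.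
  move=> X Y _ _ /(cell_path_inj hk hc) e; apply/fsetP => x.
  by rewrite -(mem_sort reads_before X) e mem_sort.
(* [F] enumerates the increasing paths by admissible sets; being injective on them, it turns the sum
   over paths into a sum over these sets. *)
have pathsE : increasing_paths k n (wla k c lam) = [set` map F r]%classic.
  apply/seteqP; split=> p.
    move=> /(increasing_pathsP hk hc lam_dec lam_c lam_H)[xs [g sz] ->].
    have eX := sort_good g.
    apply/mapP; exists [fset x in xs]%fset; last by rewrite /F eX.
    apply/rP; rewrite eX; split=> //; apply/fsubsetP => x.
    by rewrite in_fset memla; exact: good_in g.
  move=> /mapP[X /rP[sX g sz] ->].
  apply/(increasing_pathsP hk hc lam_dec lam_c lam_H).
  by exists (sort reads_before X).
rewrite wlaE hD; last exact: affine_perm_word.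
rewrite pathsE -fsbig_seq; last by rewrite map_inj_in_uniq // filter_uniq // fset_uniq.
rewrite big_map -[RHS]big_filter -/r [LHS]big_seq [RHS]big_seq.
apply: eq_bigr => X /rP[sX g sz].
rewrite path_end_cell_path.
have subs : subseq (sort reads_before X) (upper_cells lam H).
  by rewrite hsort ?filter_subseq //; exact: subP.
have [e red] := wdel_reduced hk hc lam_dec lam_c lam_H g subs.
have eL : [seq x <- upper_cells lam H | x \notin sort reads_before X] =
    sort reads_before (diagram la `\` X)%fset.
  by rewrite readE //; apply: eq_filter => x; rewrite mem_sort.
rewrite eL in e red; rewrite -e.
by rewrite /u_diag /reading_word -(u_perm_reduced hk hA.1 red).
Qed.
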